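(* Let $n\ge1$ and $Q=n+2\ge 3$. Let $2\le p<Q$ and $\beta<Q-p$. Then for every $u\in C_0^\infty(\mathbb{R}^{n+1}\setminus\{o\})$, $$\int_{\mathbb{R}^{n+1}}\frac{|\nabla_{\varrho,G}u(x,t)|^p}{\varrho^{\beta}(x,t)}\,dx\,dt-\left(\frac{Q-p-\beta}{p}\right)^p\int_{\mathbb{R}^{n+1}}\frac{|u(x,t)|^p|\nabla_G\varrho(x,t)|^p}{\varrho^{p+\beta}(x,t)}\,dx\,dt\ \ge\ c_p\left(\frac{p-1}{p}\right)^p\sup_{R>0}d_H(u,R)^p,$$ where $$c_p=\min_{0<\tau<1/2}\big[(1-\tau)^p-\tau^p+p\tau^{p-1}\big]>0$$ and $$d_H(u,R)=\left(\int_{\mathbb{R}^{n+1}}\frac{\Big|u(x,t)-R^{\frac{Q-p-\beta}{p}}\,u\big(R\tfrac{x}{\varrho(x,t)},R^2\tfrac{t}{\varrho^2(x,t)}\big)\,\varrho^{-\frac{Q-p-\beta}{p}}(x,t)\Big|^p}{\big|\ln\frac{R}{\varrho(x,t)}\big|^p\,\varrho^{p+\beta}(x,t)}\,|\nabla_G\varrho(x,t)|^p\,dx\,dt\right)^{1/p}.$$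
   Context: Grushin space $G=\mathbb{R}^{n+1}$: points $(x,t)$ with $x\in\mathbb{R}^n$, $t\in\mathbb{R}$; origin $o=(\vec 0,0)$; homogeneous dimension $Q=n+2$; homogeneous norm $\varrho(x,t)=(|x|^4+4t^2)^{1/4}$; Grushin gradient $\nabla_G=(\nabla_x,|x|\partial_t)$, so that $|\nabla_G\varrho|^2=|x|^2/\varrho^2=:\psi$ away from $o$. Polar coordinates $(\varrho,\phi,w)$: $x=\varrho\sin^{1/2}\!\phi\;w$, $w\in\mathbb{S}^{n-1}$, $t=\frac{\varrho^2}{2}\cos\phi$, $0<\phi<\pi$. $\partial_\varrho$ is the partial derivative in $\varrho$ in these coordinates, i.e. $\partial_\varrho u=\frac1\varrho(x\cdot\nabla_xu+2t\,\partial_tu)$. Radial Grushin gradient: $\nabla_{\varrho,G}u=\psi^{1/2}(\partial_\varrho u,0,0)$, so $|\nabla_{\varrho,G}u|=\psi^{1/2}|\partial_\varrho u|$. $C_0^\infty$ denotes smooth compactly supported real-valued functions. *)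

(* Defs.v *)
From HB Require Import structures.
From mathcomp Require Import all_boot all_order all_algebra.
From mathcomp Require Import all_classical all_reals all_analysis.

Set Implicit Arguments.
Unset Strict Implicit.
Unset Printing Implicit Defensive.

Import Order.TTheory GRing.Theory Num.Theory.
Import numFieldNormedType.Exports.

Local Open Scope classical_set_scope.
Local Open Scope ring_scope.

(* R^n carries the product sigma-algebra (its Borel sets): the one generated
   by the coordinate functions. *)
Section rV_measurable.
Context {R : realType} {n : nat}.

Let coord (i : 'I_n) (x : 'rV[R]_n) : measurableTypeR R := x ord0 i.

Let rV_set0 : g_sigma_preimage coord set0.
Proof. exact: sigma_algebra0. Qed.

Let rV_setC A : g_sigma_preimage coord A -> g_sigma_preimage coord (~` A).
Proof. exact: sigma_algebraC. Qed.

Let rV_bigcup (F : _^nat) : (forall i, g_sigma_preimage coord (F i)) ->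
  g_sigma_preimage coord (\bigcup_i (F i)).
Proof. exact: sigma_algebra_bigcup. Qed.

HB.instance Definition _ := @isMeasurable.Build default_measure_display
  'rV[R]_n (g_sigma_preimage coord) rV_set0 rV_setC rV_bigcup.

Lemma measurable_coord (i : 'I_n) :
  measurable_fun [set: 'rV[R]_n]
    (fun x : 'rV[R]_n => x ord0 i : measurableTypeR R).
Proof.
move=> _ Y mY; rewrite setTI; apply: sub_sigma_algebra => /=.
rewrite -bigcup_seq/=; exists i => /=; first by rewrite mem_index_enum.
by exists Y => //; rewrite setTI.
Qed.

Lemma measurable_fun_rV d (T : measurableType d) (f : T -> 'rV[R]_n) :
  (forall i, measurable_fun [set: T] (fun z => f z ord0 i : measurableTypeR R)) ->
  measurable_fun [set: T] f.
Proof.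
move=> mf; suff H : g_sigma_preimage (fun i => coord i \o f) `<=` measurable.
  move=> _ A mA; rewrite setTI; apply: H.
  by rewrite g_sigma_preimage_comp; exists A => //; rewrite setTI.
apply: smallest_sub; first exact: sigma_algebra_measurable.
rewrite -bigcup_seq; apply: bigcup_sub => i _ A [B mB <-].
exact: mf.
Qed.

End rV_measurable.

Definition rV_cons {R : realType} {n : nat} (z : measurableTypeR R * 'rV[R]_n) :
    'rV[R]_n.+1 :=
  row_mx (const_mx (z.1 : R) : 'rV_1) z.2.

(* n-dimensional Lebesgue measure, as the n-fold product of the
   one-dimensional one *)
Fixpoint lebesgue_rV {R : realType} (n : nat) : set 'rV[R]_n -> \bar R :=
  match n with
  | 0 => \d_(0 : 'rV[R]_0)
  | m.+1 => pushforward
      (product_measure1 (@lebesgue_measure R) (@lebesgue_rV R m))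
      (@rV_cons R m)
  end.
Arguments lebesgue_rV {R} n _.

Section lebesgue_rV_measure.
Context {R : realType}.
Local Open Scope ereal_scope.

Lemma rV_consE0 n (z : measurableTypeR R * 'rV[R]_n) : rV_cons z ord0 ord0 = z.1.
Proof.
rewrite /rV_cons.
have -> : @ord0 n = lshift n (@ord0 0) by exact: val_inj.
by etransitivity; [exact: row_mxEl|rewrite mxE].
Qed.

Lemma rV_consES n (z : measurableTypeR R * 'rV[R]_n) j :
  rV_cons z ord0 (lift ord0 j) = z.2 ord0 j.
Proof.
rewrite /rV_cons.
have -> : lift (@ord0 n) j = rshift 1 j by exact: val_inj.
exact: row_mxEr.
Qed.

Lemma measurable_rV_cons n :
  measurable_fun [set: measurableTypeR R * 'rV[R]_n] (@rV_cons R n).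
Proof.
apply: measurable_fun_rV => i; case: (unliftP ord0 i) => [j|] ->.
  under eq_fun do rewrite rV_consES.
  exact: measurableT_comp (measurable_coord j) measurable_snd.
under eq_fun do rewrite rV_consE0.
exact: measurable_fst.
Qed.

Definition rV_uncons n (x : 'rV[R]_n.+1) :
    measurableTypeR R * 'rV[R]_n :=
  (x ord0 ord0, \row_i x ord0 (lift ord0 i)).

Lemma rV_unconsK n : cancel (@rV_uncons n) rV_cons.
Proof.
move=> x; apply/rowP => i; case: (unliftP ord0 i) => [j|] ->.
  by rewrite rV_consES mxE.
by rewrite rV_consE0.
Qed.

Lemma rV_consK n : cancel rV_cons (@rV_uncons n).
Proof.
move=> [a x]; rewrite /rV_uncons rV_consE0; congr pair.
by apply/rowP => i; rewrite mxE rV_consES.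
Qed.

Lemma measurable_rV_uncons n : measurable_fun [set: 'rV[R]_n.+1] (@rV_uncons n).
Proof.
apply: measurable_fun_pair; first exact: measurable_coord.
apply: measurable_fun_rV => i.
under eq_fun do rewrite mxE.
exact: measurable_coord.
Qed.

Fact lebesgue_rV_subproof n :
  exists m : {sigma_finite_measure set 'rV[R]_n -> \bar R},
    @lebesgue_rV R n = m :> (set 'rV[R]_n -> \bar R).
Proof.
elim: n => [|n [m mE]].
  by exists (\d_(0%R : 'rV[R]_0) : {sigma_finite_measure set _ -> \bar R}).
pose l : {sigma_finite_measure set (measurableTypeR R) -> \bar R} :=
  @lebesgue_measure R.
pose pr : {measure set (measurableTypeR R * 'rV[R]_n)%type -> \bar R} :=
  (l \x m).
have mc := @measurable_rV_cons n.
have sf : sigma_finite setT (pushforward pr (@rV_cons R n)).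
  have /sigma_finiteP[F [FT ndF Foo]] := sigma_finiteT l.
  have /sigma_finiteP[G [GT ndG Goo]] := sigma_finiteT m.
  exists (fun k => @rV_uncons n @^-1` (F k `*` G k)).
    rewrite -preimage_bigcup (_ : \bigcup_k _ = setT) ?preimage_setT//.
    apply/seteqP; split => // -[x y] _.
    have : setT x by []. have : setT y by [].
    rewrite FT GT => -[j _ Gy] [i _ Fx]; exists (maxn i j) => //; split => /=.
    - by move: x Fx; exact/subsetPset/ndF/leq_maxl.
    - by move: y Gy; exact/subsetPset/ndG/leq_maxr.
  move=> k; have [mF Fk] := Foo k; have [mG Gk] := Goo k; split.
    rewrite -[X in measurable X]setTI.
    by apply: measurable_rV_uncons => //; exact: measurableX.
  rewrite /pushforward (_ : _ @^-1` _ = F k `*` G k).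
    by rewrite /pr /= product_measure1E// lte_mul_pinfty// ge0_fin_numE.
  rewrite -comp_preimage (_ : _ \o _ = id) ?preimage_id//.
  by apply/funext => z; exact: rV_consK.
pose q : {measure set 'rV[R]_n.+1 -> \bar R} :=
  measure_function_pushforward__canonical__measure_function_Measure pr mc.
pose sq := Measure_isSigmaFinite.Build _ _ _ (Measure.sort q) sf.
exists (HB.pack_for (SigmaFiniteMeasure.type _ R) (Measure.sort q) sq).
by rewrite /= mE.
Qed.

Let lebesgue_rV0 n : @lebesgue_rV R n set0 = 0.
Proof. by have [m ->] := lebesgue_rV_subproof n. Qed.

Let lebesgue_rV_ge0 n A : 0 <= @lebesgue_rV R n A.
Proof. by have [m ->] := lebesgue_rV_subproof n. Qed.

Let lebesgue_rV_sigma_additive n : semi_sigma_additive (@lebesgue_rV R n).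
Proof.
have [m mE] := lebesgue_rV_subproof n; rewrite mE.
exact: (@measure_semi_sigma_additive _ _ _ m).
Qed.

HB.instance Definition _ n := isMeasure.Build _ _ _ (@lebesgue_rV R n)
  (lebesgue_rV0 n) (@lebesgue_rV_ge0 n) (@lebesgue_rV_sigma_additive n).

Let lebesgue_rV_sigma_finite n : sigma_finite setT (@lebesgue_rV R n).
Proof.
have [m mE] := lebesgue_rV_subproof n; rewrite mE.
exact: (sigma_finiteT m).
Qed.

HB.instance Definition _ n := Measure_isSigmaFinite.Build _ _ _
  (@lebesgue_rV R n) (lebesgue_rV_sigma_finite n).

Lemma lebesgue_rV_box n (A : 'I_n -> set (measurableTypeR R)) : (forall i, measurable (A i)) ->
  @lebesgue_rV R n [set x | forall i, A i (x ord0 i)] =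
  \prod_(i < n) (lebesgue_measure (A i) : \bar R).
Proof.
elim: n A => [|n IH] A mA.
  rewrite big_ord0 /= /dirac indicE mem_set//.
  by move=> [].
rewrite big_ord_recl -IH; last by move=> i; exact: mA.
rewrite -[in RHS](@product_measure1E _ _ (measurableTypeR R) 'rV[R]_n R
  (@lebesgue_measure R) (@lebesgue_rV R n)).
- rewrite /= /pushforward; congr (product_measure1 _ _ _).
  apply/seteqP; split => [z /= Az|z [/= A0 AS] i].
    split=> [|i] /=; first by have := Az ord0; rewrite rV_consE0.
    by have := Az (lift ord0 i); rewrite rV_consES.
  case: (unliftP ord0 i) => [j|] ->; first by rewrite rV_consES.
  by rewrite rV_consE0.
- exact: mA.
- rewrite [X in measurable X](_ : _ = \bigcap_(i in [set: 'I_n])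
      ((fun x : 'rV[R]_n => x ord0 i : measurableTypeR R) @^-1`
        A (lift ord0 i))); last first.
    by apply/seteqP; split => [x Ax i _|x Ax i] //=; exact: Ax.
  apply: fin_bigcap_measurable => // i _.
  by rewrite -[X in measurable X]setTI; exact: measurable_coord.
Qed.

End lebesgue_rV_measure.

Section test_functions.
Context {R : realType} {V : normedModType R}.
Implicit Type f : V -> R.

(* C^oo: every iterated directional derivative exists and is (Frechet)
   differentiable, hence continuous, at every point. *)
Definition smooth f := forall (vs : seq V) (z : V),
  differentiable (foldr (fun v g => 'D_v g) f vs) z.

(* Functions of C_0^oo(V \ {0}), extended by 0 at the origin *)
Definition test_function_off0 f :=
  let supp := closure [set z | f z != 0] in
  [/\ smooth f, compact supp & ~ supp 0].

End test_functions.

Notation grushin R n := ('rV[R]_n * R)%type.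

Definition hdim (R : realType) (n : nat) : R := (n + 2)%:R.

Section grushin.
Context {R : realType} {n : nat}.
Implicit Types (u : grushin R n -> R) (z : grushin R n).

(* The Euclidean norm; `|x| on 'rV[R]_n is the sup norm. *)
Definition enorm (x : 'rV[R]_n) : R := Num.sqrt (\sum_(i < n) x ord0 i ^+ 2).

Definition rho z : R := (enorm z.1 ^+ 4 + 4 * z.2 ^+ 2) `^ 4^-1.

Definition dx (i : 'I_n) u z : R := 'D_((delta_mx ord0 i, 0) : grushin R n) u z.
Definition dt u z : R := 'D_((0, 1) : grushin R n) u z.

Definition gradG u z : grushin R n := (\row_i dx i u z, enorm z.1 * dt u z).

Definition enormG (v : grushin R n) : R := Num.sqrt (enorm v.1 ^+ 2 + v.2 ^+ 2).

Definition psi z : R := enorm z.1 ^+ 2 / rho z ^+ 2.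

Definition drho u z : R :=
  (rho z)^-1 * (\sum_(i < n) z.1 ord0 i * dx i u z + 2 * z.2 * dt u z).

(* the length of the radial gradient psi^(1/2) (drho u, 0, 0) *)
Definition norm_radial_gradG u z : R := Num.sqrt (psi z) * `|drho u z|.

Definition lebesgueG : set ('rV[R]_n * measurableTypeR R)%type -> \bar R :=
  (lebesgue_rV n \x lebesgue_measure)%E.

Definition radial_energy (p beta : R) u : \bar R :=
  \int[lebesgueG]_z ((norm_radial_gradG u z) `^ p / rho z `^ beta)%:E.

Definition hardy_term (p beta : R) u : \bar R :=
  \int[lebesgueG]_z
    (`|u z| `^ p * enormG (gradG rho z) `^ p / rho z `^ (p + beta))%:E.

Definition hardy_exponent (p beta : R) : R := (hdim R n - p - beta) / p.

(* At o and where rho = r the integrand is not meaningful as written; both sets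
   are Lebesgue-null, and division by 0 is 0 there. *)
Definition dH (p beta : R) u (r : R) : \bar R :=
  let a := hardy_exponent p beta in
  ((\int[lebesgueG]_z
    (`|u z - r `^ a *
        u ((r / rho z) *: z.1, r ^+ 2 * (z.2 / rho z ^+ 2)) *
        rho z `^ (- a)| `^ p
      / (`|ln (r / rho z)| `^ p * rho z `^ (p + beta))
      * enormG (gradG rho z) `^ p)%:E) `^ p^-1)%E.

End grushin.

Section constant.
Context {R : realType}.

Definition cp_fun (p tau : R) : R :=
  (1 - tau) `^ p - tau `^ p + p * tau `^ (p - 1).

Definition cp_values (p : R) : set R :=
  [set cp_fun p tau | tau in [set tau : R | 0 < tau < 2^-1]].

Definition is_min (A : set R) (m : R) := A m /\ lbound A m.

(* [inf] is total: this definition alone does not say that the infimum is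
   attained. *)
Definition cp (p : R) : R := inf (cp_values p).

End constant.

(* Main.v *)
(* Along an orbit s |-> delta_(e^s) z of the dilations
   delta_r (x, t) = (r x, r^2 t), put v(s) = e^(a s) u(delta_(e^s) z) with
   a = (Q - p - beta) / p. The radial energy, the Hardy term and d_H(u, R)^p then
   become, with one common weight, the integrals over the line of |v' - a v|^p,
   of |v|^p and of |(v(s) - v(S)) / (s - S)|^p, where S = ln (R / rho z). The
   pointwise inequality |A - B|^p >= |A|^p - p |A|^(p-2) A B + c_p |B|^p for
   A = a v, B = v' gives the first Hardy term up to an exact derivative; the
   convexity of |.|^p gives the one-dimensional Hardy inequality for v - v(S),
   again up to an exact derivative. Both derivatives integrate to a nonnegative
   quantity since v has compact support.

   No surface measure is needed to integrate over the orbits: for the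
   indicator chi of [1, e), the integral of chi(e^-s r) over s is 1 for every
   r > 0, so Tonelli and the scaling of Lebesgue measure under delta turn the
   integral of F into that of chi(rho z) * int_s F(delta_(e^s) z) e^(Q s) ds. *)
From HB Require Import structures.
Require Import Defs.
From mathcomp Require Import all_boot all_order all_algebra.
From mathcomp Require Import all_classical all_reals all_analysis.
From mathcomp Require Import measurable_realfun.
From mathcomp Require Import ring lra.
Set Implicit Arguments.
Unset Strict Implicit.
Unset Printing Implicit Defensive.
Import Order.TTheory GRing.Theory Num.Theory.
Import numFieldNormedType.Exports.
Local Open Scope classical_set_scope.
Local Open Scope ring_scope.

(** * Signed powers, and convexity and differentiability of [|y|^p] *)

Section signed_power.
Context {R : realType}.
Implicit Types (q p x y a b : R).

(* [|y|^(q-1) y]; so [p * spow (p - 1) y] is the derivative of [|y|^p]. *)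
Definition spow q y : R := Num.sg y * `|y| `^ q.

Lemma spow_ge0E q y : 0 < q -> 0 <= y -> spow q y = y `^ q.
Proof.
move=> q0; rewrite le_eqVlt => /predU1P[<-|y0].
  by rewrite /spow sgr0 mul0r powR0// gt_eqF.
by rewrite /spow gtr0_sg// mul1r gtr0_norm.
Qed.

Lemma spowN q y : spow q (- y) = - spow q y.
Proof. by rewrite /spow sgrN normrN mulNr. Qed.

Lemma spowM q a b : spow q (a * b) = spow q a * spow q b.
Proof. by rewrite /spow sgrM normrM powRM// mulrACA. Qed.

Lemma spow_le_norm q y : `|spow q y| <= `|y| `^ q.
Proof.
rewrite /spow normrM normr_sg (ger0_norm (powR_ge0 _ _)).
by case: eqP => [->|_]; rewrite ?mul0r ?powR_ge0// mul1r.
Qed.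

Lemma mul_spow q y : 0 < q -> spow (q - 1) y * y = `|y| `^ q.
Proof.
by move=> q0; rewrite /spow mulrAC -normrEsg mulr_powRB1.
Qed.

(** Young's inequality with conjugate exponents [q / (q - 1)] and [q], applied to [x^(q-1)] and [y]
    and cleared of denominators. *)
Lemma young_powR q x y : 1 < q -> 0 <= x -> 0 <= y ->
  q * (x `^ (q - 1) * y) <= (q - 1) * x `^ q + y `^ q.
Proof.
move=> q1 x0 y0; have q0 : 0 < q by lra.
have q10 : 0 < q - 1 by lra.
have H : x `^ (q - 1) * y <= x `^ q / (q / (q - 1)) + y `^ q / q.
  have E : x `^ q = (x `^ (q - 1)) `^ (q / (q - 1)).
    by rewrite -powRrM mulrC divfK ?gt_eqF.
  rewrite E; apply: conjugate_powR; rewrite ?powR_ge0 ?divr_gt0//.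
  by field; rewrite !gt_eqF.
have := ler_wpM2l (ltW q0) H.
suff -> : q * (x `^ q / (q / (q - 1)) + y `^ q / q) = (q - 1) * x `^ q + y `^ q by [].
by field; rewrite !gt_eqF.
Qed.

(** Convexity: the graph of [|.|^p] lies above its tangent at [a]. Since
    [spow (p - 1) a * a = |a|^p], this is Young's inequality for [|a|] and [|b|]. *)
Lemma tangent_normpow p a b : 1 < p ->
  `|a| `^ p + p * spow (p - 1) a * (b - a) <= `|b| `^ p.
Proof.
move=> p1; have p0 : 0 < p by lra.
have := young_powR p1 (normr_ge0 a) (normr_ge0 b).
have : spow (p - 1) a * b <= `|a| `^ (p - 1) * `|b|.
  rewrite (le_trans (ler_norm _))// normrM ler_wpM2r//; exact: spow_le_norm.
have := mul_spow a p0.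
set A := `|a| `^ p; set B := `|b| `^ p; set s := spow _ _; set P := `|a| `^ (p - 1).
move=> sa /(ler_wpM2l (ltW p0)) sb H.
have -> : A + p * s * (b - a) = A + p * (s * b) - p * (s * a) by ring.
rewrite sa; lra.
Qed.

Lemma continuous_norm_powR q : 0 < q -> continuous (fun y : R => `|y| `^ q).
Proof.
move=> q0; suff H (y : R) : `|z| `^ q @[z --> y] --> `|y| `^ q by [].
have [->|y0] := eqVneq y 0.
  apply/cvgrPdist_lt => e e0; rewrite normr0 powR0 ?gt_eqF//.
  have d0 : 0 < e `^ q^-1 by exact: powR_gt0.
  have eE : e = (e `^ q^-1) `^ q by rewrite -powRrM mulVf ?gt_eqF// powRr1 ?ltW.
  near=> z; rewrite sub0r normrN (ger0_norm (powR_ge0 _ _)).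
  rewrite [ltRHS]eE; apply: gt0_ltr_powR; rewrite ?nnegrE ?powR_ge0//.
have H1 : `|z| @[z --> y] --> `|y| by exact: norm_continuous.
suff H2 : z `^ q @[z --> `|y|] --> `|y| `^ q by exact: cvg_comp H1 H2.
suff : differentiable (@powR R ^~ q : R -> R) `|y| by move=> /differentiable_continuous.
by apply/derivable1_diffP; apply: derivable_powR; rewrite in_itv/= normr_gt0 y0.
Unshelve. all: by end_near. Qed.

Lemma continuous_spow q : 0 < q -> continuous (spow q).
Proof.
move=> q0; suff H (y : R) : spow q z @[z --> y] --> spow q y by [].
have [y0|y0|->] := ltgtP y 0.
- rewrite {2}/spow ltr0_sg// mulN1r.
  have H : - (`|z| `^ q) @[z --> y] --> - (`|y| `^ q).
    by apply: cvgN; exact: continuous_norm_powR.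
  apply: cvg_trans H; apply: near_eq_cvg; near=> z.
  by rewrite /spow ltr0_sg ?mulN1r//; near: z; exact: lt_nbhsl.
- rewrite {2}/spow gtr0_sg// mul1r.
  have H : `|z| `^ q @[z --> y] --> `|y| `^ q by exact: continuous_norm_powR.
  apply: cvg_trans H; apply: near_eq_cvg; near=> z.
  by rewrite /spow gtr0_sg ?mul1r//; near: z; exact: lt_nbhsr.
- rewrite {2}/spow sgr0 mul0r; apply/cvgr0Pnorm_lt => e e0.
  have : `|z| `^ q @[z --> (0:R)] --> (0:R).
    by have := @continuous_norm_powR q q0 0; rewrite /continuous_at normr0 powR0 ?gt_eqF.
  move=> /cvgr0Pnorm_lt/(_ _ e0) H; near=> z.
  rewrite (le_lt_trans (spow_le_norm _ _))// -[ltLHS]ger0_norm ?powR_ge0//.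
  by near: z.
Unshelve. all: by end_near. Qed.

Lemma is_derive_norm_powR p y : 1 < p ->
  is_derive y 1 (fun x : R => `|x| `^ p) (p * spow (p - 1) y).
Proof.
move=> p1; have [y0|y0|->] := ltgtP y 0.
- apply: (@near_eq_is_derive _ _ _ (fun x => (- x) `^ p)).
    near=> x; rewrite ltr0_norm//; near: x; exact: lt_nbhsl.
  have y0' : 0 < - y by rewrite oppr_gt0.
  have h := is_derive1_powR p y0'.
  have h2 : is_derive y (1:R) (-%R : R -> R) (-1) by exact: is_deriveNid.
  apply: is_derive_eq (is_derive1_comp h h2) _.
  by rewrite /spow ltr0_sg// ltr0_norm//; ring.
- apply: (@near_eq_is_derive _ _ _ (fun x => x `^ p)).
    near=> x; rewrite gtr0_norm//; near: x; exact: lt_nbhsr.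
  by apply: is_derive_eq (is_derive1_powR p y0) _; rewrite /spow gtr0_sg// gtr0_norm// mul1r.
(* At 0 the identity [|z|^p = spow (p - 1) z * z] exhibits the difference quotient, which is
   continuous and vanishes at 0. *)
- apply/is_derive1_caratheodory; exists (spow (p - 1)); split => [z||].
  + have p0 : 0 < p by lra.
    by rewrite normr0 (powR0 (_ : p != 0)) ?gt_eqF// !subr0 mul_spow.
  + by apply: continuous_spow; rewrite subr_gt0.
  + by rewrite /spow sgr0 !mul0r mulr0.
Unshelve. all: by end_near. Qed.

Lemma is_derive_spow q y : 1 < q ->
  is_derive y 1 (spow q) (q * `|y| `^ (q - 1)).
Proof.
move=> q1; have q0 : 0 < q by lra.
have [y0|y0|->] := ltgtP y 0.
- apply: (@near_eq_is_derive _ _ _ (fun x => - (`|x| `^ q))).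
    near=> x; rewrite /spow ltr0_sg ?mulN1r//; near: x; exact: lt_nbhsl.
  have h := is_derive_norm_powR y q1.
  by apply: is_derive_eq (is_deriveN h) _; rewrite /spow ltr0_sg//; ring.
- apply: (@near_eq_is_derive _ _ _ (fun x => `|x| `^ q)).
    near=> x; rewrite /spow gtr0_sg ?mul1r//; near: x; exact: lt_nbhsr.
  by apply: is_derive_eq (is_derive_norm_powR y q1) _; rewrite /spow gtr0_sg//; ring.
(* Likewise [spow q z = |z|^(q-1) * z] exhibits the difference quotient at 0. *)
- apply/is_derive1_caratheodory; exists (fun y => `|y| `^ (q - 1)); split => [z||].
  + rewrite {2}/spow sgr0 mul0r !subr0 /spow.
    by rewrite -(mulr_powRB1 (normr_ge0 z) q0) mulrA -numEsg mulrC.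
  + by apply: continuous_norm_powR; rewrite subr_gt0.
  + by rewrite normr0 powR0 ?mulr0// gt_eqF// subr_gt0.
Unshelve. all: by end_near. Qed.

End signed_power.

(** * The constant [cp p] and the pointwise inequality it governs *)

Section cp_minimum.
Context {R : realType}.
Implicit Types (p a b tau : R).

(* A C^1 extension of [cp_fun p] from (0, 1/2) to the whole line: the minimum over
   (0, 1/2) turns out to be the global minimum of the extension. *)
Definition cp_ext p tau : R :=
  `|tau - 1| `^ p - `|tau| `^ p + p * spow (p - 1) tau.

Lemma cp_extE p tau : 1 < p -> 0 < tau < 2^-1 -> cp_ext p tau = cp_fun p tau.
Proof.
move=> p1 /andP[t0 t1]; rewrite /cp_ext /cp_fun spow_ge0E ?subr_gt0 1?ltW//.
by rewrite (gtr0_norm t0) distrC gtr0_norm// subr_gt0; lra.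
Qed.

Lemma cp_ext2 tau : cp_ext 2 tau = 1.
Proof.
rewrite /cp_ext !powR_mulrn ?normr_ge0// !real_normK ?num_real//.
have -> : 2 - 1 = 1 :> R by lra.
rewrite /spow powRr1// -numEsg; ring.
Qed.

Let dcp p tau :=
  p * (spow (p - 1) (tau - 1) - spow (p - 1) tau + (p - 1) * `|tau| `^ (p - 2)).

Lemma is_derive_cp_ext p tau : 2 < p -> is_derive tau 1 (cp_ext p) (dcp p tau).
Proof.
move=> p2; have p1 : 1 < p by lra.
have p11 : 1 < p - 1 by lra.
have h1 : is_derive tau (1 : R) (fun x : R => `|x - 1| `^ p) (p * spow (p - 1) (tau - 1)).
  have h2 : is_derive tau (1 : R) (fun x : R => x - 1) 1.
    exact: (is_derive_shift tau (1 : R) (- 1)).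
  have h3 := is_derive_norm_powR (tau - 1) p1.
  apply: is_derive_eq (@is_derive1_comp _ (fun x => `|x| `^ p) (fun x => x - 1) _ _ _ h3 h2) _.
  by rewrite mulr1.
have h3 := is_derive_norm_powR tau p1.
have h4 := is_derive_spow tau p11.
have h5 := is_deriveD (is_deriveB h1 h3) (is_deriveZ p h4).
apply: is_derive_eq h5 _; rewrite /dcp /GRing.scale/=.
have -> : p - 1 - 1 = p - 2 by ring.
by ring.
Qed.

(** For [tau >= 1] this is the tangent inequality of exponent [p - 1] at [tau], evaluated at
    [tau - 1]. For [1/2 <= tau <= 1] the bound [(1 - tau)^(p-2) <= tau^(p-2)] leaves at least
    [p (p - 2) tau^(p-2)]. *)
Lemma dcp_ge0 p tau : 2 < p -> 2^-1 <= tau -> 0 <= dcp p tau.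
Proof.
move=> p2 t2; have t0 : 0 <= tau by lra.
have p20 : 0 < p - 2 by lra.
have p10 : 0 < p - 1 by lra.
have p21 : p - 1 - 1 = p - 2 by ring.
apply: mulr_ge0; first by lra.
rewrite (spow_ge0E p10 t0) (ger0_norm t0).
have [t1|/ltW t1] := leP 1 tau.
  have := @tangent_normpow _ (p - 1) tau (tau - 1).
  rewrite p21 (spow_ge0E p20 t0) (spow_ge0E p10) ?subr_ge0//.
  rewrite (ger0_norm t0) ger0_norm ?subr_ge0// => /(_ ltac:(lra)).
  have -> : tau - 1 - tau = -1 by ring.
  lra.
rewrite -[tau - 1]opprB spowN spow_ge0E ?subr_ge0//.
have E (x : R) : 0 <= x -> x `^ (p - 1) = x * x `^ (p - 2).
  by move=> x0; rewrite -p21 mulr_powRB1.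
rewrite !E ?subr_ge0//.
have := @ge0_ler_powR R (p - 2) (ltW p20) (1 - tau) tau.
rewrite !nnegrE subr_ge0 => /(_ t1 t0 ltac:(lra)) H.
have P0 := powR_ge0 tau (p - 2).
have t1' : 0 <= 1 - tau by lra.
have := ler_wpM2l t1' H.
have : 0 <= (p - 2) * tau `^ (p - 2) by rewrite mulr_ge0// ltW.
lra.
Qed.

(** The tangent inequality of exponent [p - 1] at [- tau], evaluated at [1 - tau]. *)
Lemma dcp_le0 p tau : 2 < p -> tau <= 0 -> dcp p tau <= 0.
Proof.
move=> p2 t2; have t0 : 0 <= - tau by lra.
have t1 : 0 <= - (tau - 1) by lra.
have p20 : 0 < p - 2 by lra.
have p10 : 0 < p - 1 by lra.
have p21 : p - 1 - 1 = p - 2 by ring.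
apply: mulr_ge0_le0; first by lra.
have := @tangent_normpow _ (p - 1) (- tau) (- (tau - 1)).
rewrite p21 (spow_ge0E p20 t0) (ger0_norm t0) (ger0_norm t1).
have E (x : R) : 0 <= - x -> spow (p - 1) x = - (- x) `^ (p - 1).
  by move=> x0; rewrite -(spow_ge0E p10 x0) spowN opprK.
rewrite (E _ t0) (E _ t1) (ler0_norm t2).
move=> /(_ ltac:(lra)).
have -> : - (tau - 1) - - tau = 1 by ring.
lra.
Qed.

(* The minimum on [0, 1/2] is global, hence a critical point, and the
   derivative does not vanish at 0 and 1/2. *)
Lemma cp_ext_min p : 2 <= p ->
  exists2 c, 0 < c < 2^-1 & forall tau, cp_ext p c <= cp_ext p tau.
Proof.
rewrite le_eqVlt => /predU1P[<-|p2].
  (* For [p = 2] the extension is constant, so any point of (0, 1/2) serves. *)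
  by exists 4^-1; [lra|move=> tau; rewrite !cp_ext2].
have dF tau := is_derive_cp_ext tau p2.
have derF tau : derivable (cp_ext p) tau 1 by have [] := dF tau.
have dF1 tau : (cp_ext p)^`()%classic tau = dcp p tau by rewrite derive1E; have [] := dF tau.
have cF : continuous (cp_ext p).
  by move=> x; apply: differentiable_continuous; apply/derivable1_diffP.
have i2 : 0 <= 2^-1 :> R by rewrite invr_ge0.
have [c /[!in_itv]/= /andP[c0 c2] cmin] :=
  EVT_min i2 (continuous_subspaceT cF).
have glob tau : cp_ext p c <= cp_ext p tau.
  have [t0|t0] := leP tau 0.
    apply: (@le_trans _ _ (cp_ext p 0)); first by apply: cmin; rewrite in_itv/= lexx.
    apply: (@ler0_derive1_nincrNy _ (cp_ext p) 0) => //.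
    - by move=> x /[!in_itv]/= x0; rewrite dF1 dcp_le0// ltW.
    - exact: continuous_subspaceT.
  have [t2|t2] := leP 2^-1 tau.
    apply: (@le_trans _ _ (cp_ext p 2^-1)); first by apply: cmin; rewrite in_itv/= lexx andbT.
    apply: (@ger0_derive1_ndecry _ (cp_ext p) 2^-1) => //.
    - by move=> x /[!in_itv]/= /andP[x0 _]; rewrite dF1 dcp_ge0// ltW.
    - exact: continuous_subspaceT.
  by apply: cmin; rewrite in_itv/= !ltW.
have dc0 : dcp p c = 0.
  have h : is_derive c 1 (cp_ext p) 0.
    apply: (@derive1_at_min _ _ (c - 1) (c + 1)) => //; first lra.
    by rewrite in_itv/=; lra.
  by rewrite -dF1 derive1E; have [_ ->] := h.
have p20 : 0 < p - 2 by lra.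
have p10 : 0 < p - 1 by lra.
(* The derivative is [- p] at 0 and [p (p - 2) 2^-(p-2)] at 1/2, both nonzero for [p > 2], so [c] is
   neither endpoint. *)
exists c => //; rewrite !lt_neqAle c0 c2 !andbT; apply/andP; split.
  apply/eqP => c0'; move: dc0; rewrite /dcp -c0' normr0 powR0 ?gt_eqF//.
  rewrite sub0r spowN !spow_ge0E// powR1 powR0 ?gt_eqF// => /eqP.
  by rewrite mulf_eq0; lra.
apply/eqP => c2'; move: dc0; rewrite /dcp c2'.
have -> : 2^-1 - 1 = - 2^-1 :> R by lra.
rewrite spowN !spow_ge0E// ger0_norm//.
have -> : 2^-1 `^ (p - 1) = 2^-1 * 2^-1 `^ (p - 2) :> R.
  by have <- : p - 1 - 1 = p - 2 by [ring|]; rewrite mulr_powRB1.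
have P0 : 0 < 2^-1 `^ (p - 2) :> R by rewrite powR_gt0// invr_gt0.
set P := _ `^ _ in P0 *.
have -> : p * (- (2^-1 * P) - 2^-1 * P + (p - 1) * P) = p * (p - 2) * P.
  by field.
move=> /eqP; rewrite !mulf_eq0; lra.
Qed.

Lemma cp_properties p : 2 <= p ->
  [/\ is_min (cp_values p) (cp p), 0 < cp p &
      forall tau, cp p <= cp_ext p tau].
Proof.
move=> p2; have p1 : 1 < p by lra.
have [c c02 cmin] := cp_ext_min p2.
have m : is_min (cp_values p) (cp_ext p c).
  split; first by exists c => //; rewrite cp_extE.
  by move=> _ [t t02 <-]; rewrite -cp_extE.
have -> : cp p = cp_ext p c.
  apply/le_anti/andP; split.
    by apply: ge_inf; [exists (cp_ext p c); exact: m.2|exact: m.1].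
  by apply: lb_le_inf; [exists (cp_ext p c); exact: m.1|exact: m.2].
(* Positivity: [c < 1/2] gives [(1 - c)^p > c^p], and the last summand is nonnegative. *)
split => //; rewrite cp_extE// /cp_fun.
case/andP: c02 => c0 c2; rewrite ltr_wpDr ?mulr_ge0 ?powR_ge0//; first lra.
by rewrite subr_gt0 gt0_ltr_powR ?nnegrE//; lra.
Qed.

(** Both sides are homogeneous of degree [p]: for [b != 0] this is the bound
    [cp p <= cp_ext p (a / b)] multiplied by [|b|^p]. The quotient [a / b] is arbitrary, which is
    why the minimum had to be global. *)
Lemma cp_ineq p a b : 2 <= p ->
  `|a| `^ p - p * spow (p - 1) a * b + cp p * `|b| `^ p <= `|a - b| `^ p.
Proof.
move=> p2; have p0 : 0 < p by lra.
have p10 : 0 < p - 1 by lra.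
have [->|b0] := eqVneq b 0.
  by rewrite normr0 powR0 ?gt_eqF// !mulr0 !subr0 addr0.
have [_ _ /(_ (a / b))] := cp_properties p2.
have nb : 0 <= `|b| `^ p := powR_ge0 _ _.
move=> /(ler_wpM2r nb); rewrite /cp_ext mulrDl mulrBl.
rewrite -!powRM// -!normrM mulrBl mul1r divfK//.
have -> : p * spow (p - 1) (a / b) * `|b| `^ p = p * spow (p - 1) a * b.
  by rewrite -(mul_spow b p0) mulrA -[p * _ * _]mulrA -spowM divfK.
lra.
Qed.

End cp_minimum.

(** * Comparing integrals on the line up to an exact derivative *)

Section line_comparison.
Context {R : realType}.
Local Notation mu := (@lebesgue_measure R).
Implicit Types (f g Phi phi : R -> R).

Lemma le_integral_primitive f g Phi phi (c d : R) : c < d ->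
  (forall x, c <= x <= d -> {for x, continuous f}) ->
  (forall x, c <= x <= d -> {for x, continuous g}) ->
  (forall x, c <= x <= d -> {for x, continuous phi}) ->
  (forall x, c <= x <= d -> is_derive x 1 Phi (phi x)) ->
  (forall x, c <= x <= d -> g x + phi x <= f x) ->
  (\int[mu]_(x in `[c, d]) (g x)%:E + (Phi d - Phi c)%:E
    <= \int[mu]_(x in `[c, d]) (f x)%:E)%E.
Proof.
move=> cd cf cg cphi dPhi H.
have within (h : R -> R) : (forall x, c <= x <= d -> {for x, continuous h}) ->
    {within `[c, d], continuous h}.
  move=> ch; apply/subspace_continuousP => x /=; rewrite in_itv/= => xcd.
  by apply: cvg_within_filter; exact: ch.
have intg (h : R -> R) : (forall x, c <= x <= d -> {for x, continuous h}) ->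
    mu.-integrable `[c, d] (EFin \o h).
  move=> ch; apply: continuous_compact_integrable; first exact: segment_compact.
  exact: within.
have cPhi x : c <= x <= d -> {for x, continuous Phi}.
  by move=> /dPhi dx; apply: differentiable_continuous; apply/derivable1_diffP.
have FTC : (\int[mu]_(x in `[c, d]) (phi x)%:E = (Phi d)%:E - (Phi c)%:E)%E.
  apply: continuous_FTC2 => //; first exact: within.
  - split.
    + by move=> x /[!in_itv]/= /andP[cx xd]; have [] := dPhi x _; rewrite ?ltW.
    + by apply: cvg_at_right_filter; apply: cPhi; rewrite lexx ltW.
    + by apply: cvg_at_left_filter; apply: cPhi; rewrite lexx ltW.
  - move=> x /[!in_itv]/= /andP[cx xd]; rewrite derive1E.
    by have [|_ ->] := dPhi x _; rewrite ?ltW.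
rewrite EFinB -FTC -integralD//; [|exact: (intg g)|exact: (intg phi)].
apply: le_integral => //; last 2 first.
- exact: (intg f).
- by move=> x; rewrite inE/= in_itv/= => xcd; rewrite lee_fin H.
- rewrite (_ : (fun _ => _) = (EFin \o g) \+ (EFin \o phi))%E//.
  by apply: integrableD => //; exact: intg.
Qed.

(** The inequality is integrated over two segments on either side of [S] that exhaust the line. The
    outer boundary terms of [Phi] have a favourable sign, and the inner ones cancel in the limit
    because [Phi] is continuous at [S]. *)
Lemma le_integral_punctured_primitive f g Phi phi (S N : R) :
  measurable_fun [set: R] f -> measurable_fun [set: R] g ->
  (forall x, 0 <= f x) -> (forall x, 0 <= g x) ->
  (forall x, x != S -> {for x, continuous f}) ->
  (forall x, x != S -> {for x, continuous g}) ->
  (forall x, x != S -> {for x, continuous phi}) ->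
  (forall x, x != S -> is_derive x 1 Phi (phi x)) ->
  (forall x, x != S -> g x + phi x <= f x) ->
  {for S, continuous Phi} ->
  (forall x, N <= x -> 0 <= Phi x) -> (forall x, x <= - N -> Phi x <= 0) ->
  (\int[mu]_x (g x)%:E <= \int[mu]_x (f x)%:E)%E.
Proof.
move=> mf mg f0 g0 cf cg cphi dPhi H cPhi PhiN PhiNN.
pose e (k : nat) : R := k.+1%:R^-1.
(* The outer radius [k + 2] exceeds [e k <= 1], so that both segments are nondegenerate already for
   [k = 0]. *)
pose B k : set R := `[S - k.+2%:R, S - e k]%classic.
pose C k : set R := `[S + e k, S + k.+2%:R]%classic.
have e0 k : 0 < e k by rewrite invr_gt0.
have e1 k : e k <= 1 by rewrite invf_le1// ler1n.
have k2 k : e k < k.+2%:R :> R by rewrite (le_lt_trans (e1 k))// ltr1n.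
have mB k : measurable (B k) by exact: measurable_itv.
have mC k : measurable (C k) by exact: measurable_itv.
have BC k : [disjoint B k & C k].
  rewrite disj_set2E; apply/eqP/seteqP; split => // x [].
  by rewrite /B /C /= !in_itv/=; have := e0 k; lra.
have inteq (h : R -> R) (k : nat) : measurable_fun [set: R] h -> (forall x, 0 <= h x) ->
    (\int[mu]_(x in B k `|` C k) (h x)%:E =
     \int[mu]_(x in B k) (h x)%:E + \int[mu]_(x in C k) (h x)%:E)%E.
  move=> mh h0; apply: ge0_integral_setU.
  - exact: mB.
  - exact: mC.
  - by apply/measurable_EFinP; apply: measurable_funTS.
  - by move=> x _; rewrite lee_fin.
  - exact: BC.
have step k : (\int[mu]_(x in B k `|` C k) (g x)%:E
    + (Phi (S + k.+2%:R) - Phi (S + e k) + (Phi (S - e k) - Phi (S - k.+2%:R)))%:E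
    <= \int[mu]_x (f x)%:E)%E.
  apply: (@le_trans _ _ (\int[mu]_(x in B k `|` C k) (f x)%:E)%E); last first.
    apply: ge0_subset_integral => //; first exact: (measurableU _ _ (mB k) (mC k)).
    - exact/measurable_EFinP.
    - by move=> x _; rewrite lee_fin.
  rewrite !inteq// EFinD [X in (_ + X <= _)%E]addeC addeACA; apply: leeD.
  { apply: (@le_integral_primitive _ _ _ phi); first by have := k2 k; lra.
    all: move=> x /andP[x1 x2].
    all: have xS : x != S by apply/eqP => xS; move: x2; have := e0 k; lra.
    all: by [exact: cf|exact: cg|exact: cphi|exact: dPhi|exact: H]. }
  { apply: (@le_integral_primitive _ _ _ phi); first by have := k2 k; lra.
  all: move=> x /andP[x1 x2].
  all: have xS : x != S by apply/eqP => xS; move: x1; have := e0 k; lra.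
  all: by [exact: cf|exact: cg|exact: cphi|exact: dPhi|exact: H]. }
have mono : {homo (fun k => B k `|` C k) : n m / (n <= m)%N >-> (n <= m)%O}.
  move=> n m nm; apply/subsetPset => x.
  have nm2 : n.+2%:R <= m.+2%:R :> R by rewrite ler_nat.
  have nme : e m <= e n by rewrite lef_pV2 ?posrE ?ltr0n// ler_nat.
  rewrite /B /C /= !in_itv/= => -[|] /andP[x1 x2]; [left|right]; apply/andP; split; lra.
have cup : \bigcup_k (B k `|` C k) = [set: R] `\ S.
  apply/seteqP; split => x.
    move=> [k _]; rewrite /B /C /= !in_itv/= => -[|] /andP[x1 x2].
      by split => // xS; have := e0 k; lra.
    by split => // xS; have := e0 k; lra.
  move=> [_ /= /eqP xS].
  have xS0 : 0 < `|x - S| by rewrite normr_gt0 subr_eq0.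
  near \oo => k; exists k => //.
  have h1 : e k < `|x - S| by near: k; exact: (near_infty_natSinv_lt (PosNum xS0)).
  have h2 : `|x - S| <= k%:R by near: k; exact: nbhs_infty_ger.
  have kk : k%:R <= k.+2%:R :> R by rewrite ler_nat ltnW.

  rewrite /B /C /= !in_itv/=.
  have [xS1|xS1] := leP x S; [left|right].
    by move: h1 h2; rewrite ler0_norm ?subr_le0//; lra.
  by move: h1 h2; rewrite gtr0_norm ?subr_gt0//; lra.
(* Monotone convergence over the exhausting sets; the missing point [S] is null. *)
have lim1 : (\int[mu]_(x in B k `|` C k) (g x)%:E)%E @[k --> \oo] -->
    (\int[mu]_x (g x)%:E)%E.
  rewrite -(@integral_setD1 _ _ S setT).
  - rewrite -cup.
    have mg' k : measurable_fun (B k `|` C k) (fun x => (g x)%:E).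
      by apply/measurable_EFinP; apply: measurable_funTS.
    have g0' k x : (B k `|` C k) x -> (0 <= (g x)%:E)%E by rewrite lee_fin.
    have mBC k := measurableU _ _ (mB k) (mC k).
    exact (ge0_nondecreasing_set_cvg_integral (mu := mu) mono mBC mg' g0').
  - exact: measurableD.
  - by apply/measurable_EFinP; apply: measurable_funTS.
have ecvg : e k @[k --> \oo] --> (0 : R) by exact: cvg_harmonic.
have SP : S + e k @[k --> \oo] --> S.
  by rewrite -[X in _ --> X]addr0; apply: cvgD => //; exact: cvg_cst.
have SN : S - e k @[k --> \oo] --> S.
  by rewrite -[X in _ --> X]subr0; apply: cvgB => //; exact: cvg_cst.
have lim2 : Phi (S + e k) - Phi (S - e k) @[k --> \oo] --> (0 : R).
  rewrite -[X in _ --> X](subrr (Phi S)).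
  exact: cvgB (cvg_comp _ _ SP cPhi) (cvg_comp _ _ SN cPhi).
have lim3 : (\int[mu]_x (f x)%:E + (Phi (S + e k) - Phi (S - e k))%:E)%E @[k --> \oo]
    --> (\int[mu]_x (f x)%:E)%E.
  rewrite -[X in _ --> X]adde0; apply: cvgeD.
  - by rewrite fin_num_adde_defl.
  - exact: cvg_cst.
  - by apply: cvg_EFin => //; near=> k.
rewrite -(cvg_lim _ lim1)// -(cvg_lim _ lim3)//.
apply: lee_lim.
- by apply/cvg_ex; eexists; exact: lim1.
- by apply/cvg_ex; eexists; exact: lim3.
near=> k.
have := step k.
(* Large enough for [S + (k + 2) >= N] and [S - (k + 2) <= - N]. *)
have hk : `|S| + `|N| <= k.+2%:R.
  apply: (@le_trans _ _ k%:R); last by rewrite ler_nat ltnW.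
  by near: k; exact: nbhs_infty_ger.
have P1 : 0 <= Phi (S + k.+2%:R).
  by apply: PhiN; move: hk (ler_norm N) (ler_norm (- S)); rewrite normrN; lra.
have P2 : Phi (S - k.+2%:R) <= 0.
  by apply: PhiNN; move: hk (ler_norm N) (ler_norm S); lra.
move=> st; rewrite -leeBlDr//; apply: le_trans st.
rewrite -EFinN leeD2l// lee_fin; lra.
Unshelve. all: by end_near. Qed.

End line_comparison.

(** * The one-dimensional Hardy inequality with remainder *)

Section hardy_line.
Context {R : realType}.
Local Notation mu := (@lebesgue_measure R).

(* For [q = (v - v S) / (s - S)] the bracketed summand is the derivative in [s] of
   [cp p * c^(p-1) * |q|^p (s - S) - a^(p-1) * |v|^p]. *)
Lemma hardy_line_pointwise (p a c v v' q : R) : 2 <= p -> 0 < a ->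
  c = (p - 1) / p ->
  a `^ p * `|v| `^ p + cp p * c `^ p * `|q| `^ p
    + (cp p * c `^ (p - 1) * (p * spow (p - 1) q * v' - (p - 1) * `|q| `^ p)
       - a `^ (p - 1) * (p * spow (p - 1) v * v'))
  <= `|v' - a * v| `^ p.
Proof.
move=> p2 a0 cE; have p1 : 1 < p by lra.
have p0 : 0 < p by lra.
have p10 : 0 < p - 1 by lra.
have c0 : 0 < c by rewrite cE divr_gt0.
have [_ cp0 _] := cp_properties p2.
have := cp_ineq (a * v) v' p2.
rewrite (distrC (a * v)) normrM (gtr0_norm a0) powRM ?(ltW a0)//.
rewrite spowM (spow_ge0E p10 (ltW a0)).
(* The tangent is taken at [c * q] because [p * c = p - 1]: then [p (v' - c q)] is
   [p v' - (p - 1) q], as in the derivative of [|q|^p (s - S)]. *)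
have := tangent_normpow (c * q) v' p1.
rewrite normrM (gtr0_norm c0) powRM ?(ltW c0)//.
rewrite spowM (spow_ge0E p10 (ltW c0)).
have -> : p * (c `^ (p - 1) * spow (p - 1) q) * (v' - c * q) =
    c `^ (p - 1) * (p * spow (p - 1) q * v') - c `^ (p - 1) * (p - 1) * (spow (p - 1) q * q).
  by rewrite cE; field; rewrite gt_eqF.
rewrite (mul_spow q p0).
move=> /(ler_wpM2l (ltW cp0)).
set A := `|v| `^ p; set B := `|q| `^ p; set C := spow _ q; set D := spow _ v.
set E := `|v'| `^ p; set F := `|_| `^ p.
nra.
Qed.

(** The factorisation [x^-1 = x * (|x|^(-1))^2] reduces this to measurability of real powers; at 0
    both sides are 0. *)
Lemma measurable_invr : measurable_fun [set: R] (@GRing.inv R).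
Proof.
rewrite (_ : @GRing.inv R = fun x => x * (`|x| `^ (-1)) ^+ 2).
  apply: measurable_funM => //; apply: measurable_funX.
  by apply: (measurableT_comp (@measurable_powR R (-1))).
apply/funext => x; rewrite powR_inv1// exprVn real_normK ?num_real//.
have [->|x0] := eqVneq x 0; first by rewrite invr0 mul0r.
by rewrite expr2 invfM mulrA divff// mul1r.
Qed.

(* At [s = S] the quotient is [0], by division by zero. *)
Lemma hardy_line (p a S N : R) (v v' : R -> R) : 2 <= p -> 0 < a -> 0 <= N ->
  (forall s : R, is_derive s (1 : R) v (v' s)) -> continuous v' ->
  (forall s : R, N <= `|s| -> v s = 0) ->
  (\int[mu]_s (a `^ p * `|v s| `^ p
      + cp p * ((p - 1) / p) `^ p * `|(v s - v S) / (s - S)| `^ p)%:E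
    <= \int[mu]_s (`|v' s - a * v s| `^ p)%:E)%E.
Proof.
move=> p2 a0 N0 dv cv' vN; have p1 : 1 < p by lra.
have p0 : 0 < p by lra.
have p10 : 0 < p - 1 by lra.
pose c := (p - 1) / p.
have c0 : 0 < c by rewrite divr_gt0.
have [_ cp0 _] := cp_properties p2.
have cv : continuous v.
  by move=> s; apply: differentiable_continuous; apply/derivable1_diffP; have [] := dv s.
pose q s := (v s - v S) / (s - S).
have cw s : {for s, continuous (fun s => v s - v S)}.
  by apply: continuousB; [exact: cv|exact: cst_continuous].
have cS s : {for s, continuous (fun s : R => s - S)}.
  apply: differentiable_continuous; apply/derivable1_diffP.
  by have [] := is_derive_shift s (1 : R) (- S).
have cq s : s != S -> {for s, continuous q}.
  move=> sS; apply: continuousM; first exact: cw.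
  by apply: continuousV; [rewrite subr_eq0|exact: cS].
have cnp (h : R -> R) s : {for s, continuous h} -> {for s, continuous (fun s => `|h s| `^ p)}.
  move=> ch; apply: (@continuous_comp _ _ _ h (fun y => `|y| `^ p)) => //.
  exact: continuous_norm_powR.
have csp (h : R -> R) s : {for s, continuous h} ->
    {for s, continuous (fun s => spow (p - 1) (h s))}.
  move=> ch; apply: (@continuous_comp _ _ _ h (spow (p - 1))) => //.
  exact: continuous_spow.
have cfM (h k : R -> R) s : {for s, continuous h} -> {for s, continuous k} ->
   {for s, continuous (fun s => h s * k s)} by move=> ch ck; exact: continuousM.
have ccM (h : R -> R) k s : {for s, continuous h} -> {for s, continuous (fun s => k * h s)}.
  by move=> ch; apply: (@cfM _ _ _) => //; exact: cst_continuous.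
have cfB (h k : R -> R) s : {for s, continuous h} -> {for s, continuous k} ->
   {for s, continuous (fun s => h s - k s)} by move=> ch ck; exact: continuousB.
have mc (h : R -> R) : continuous h -> measurable_fun [set: R] h.
  exact: continuous_measurable_fun.
have cf s : {for s, continuous (fun s => `|v' s - a * v s| `^ p)}.
  apply: (cnp (fun s => v' s - a * v s)); apply: (@cfB _ _ _); first exact: cv'.
  by apply: (ccM v); exact: cv.
have cvp s : {for s, continuous (fun s => `|v s| `^ p)} by apply: (cnp v); exact: cv.
have cqp s : s != S -> {for s, continuous (fun s => `|q s| `^ p)}.
  by move=> sS; apply: (cnp q); exact: cq.
pose G s := `|q s| `^ p * (s - S).
pose Phi s := cp p * c `^ (p - 1) * G s - a `^ (p - 1) * `|v s| `^ p.
apply: (@le_integral_punctured_primitive _ _ _ Phi (fun s =>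
  cp p * c `^ (p - 1) * (p * spow (p - 1) (q s) * v' s - (p - 1) * `|q s| `^ p)
       - a `^ (p - 1) * (p * spow (p - 1) (v s) * v' s)) S (N + `|S|)).
- apply: mc => s; exact: cf.
- apply: measurable_funD; apply: measurable_funM => //.
    by apply: mc => s; exact: cvp.
  apply: (measurableT_comp (@measurable_powR R p)).
  apply: (measurableT_comp (@normr_measurable R setT)); apply: measurable_funM.
    by apply: mc => s; exact: cw.
  by apply: (measurableT_comp measurable_invr); apply: mc => s; exact: cS.
- by move=> s; exact: powR_ge0.
- by move=> s; rewrite addr_ge0// ?mulr_ge0 ?powR_ge0// ltW.
- by move=> s _; exact: cf.
- move=> s sS; apply: continuousD; apply: (@ccM _ _ _); first exact: cvp.
  exact: cqp.
- move=> s sS; apply: (@cfB _ _ _); apply: (@ccM _ _ _).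
    apply: (@cfB _ _ _); last by apply: (@ccM _ _ _); exact: cqp.
    apply: (@cfM _ _ _); last exact: cv'.
    by apply: (@ccM _ _ _); apply: (csp q); exact: cq.
  apply: (@cfM _ _ _); last exact: cv'.
  by apply: (@ccM _ _ _); apply: (csp v); exact: cv.
- move=> s sS; have sS0 : s - S != 0 by rewrite subr_eq0.
  have dS : is_derive s (1 : R) (fun s : R => s - S) 1.
    exact: (is_derive_shift s (1 : R) (- S)).
  have dw : is_derive s (1 : R) (fun s : R => v s - v S) (v' s).
    apply: is_derive_eq (is_deriveB (dv s) (is_derive_cst (v S) s (1 : R))) _.
    by rewrite subr0.
  have dq : is_derive s (1 : R) q ((v' s - q s) / (s - S)).
    have dV := @is_deriveV R (fun s => s - S) s 1 1 sS0 dS.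
    apply: is_derive_eq (is_deriveM dw dV) _.
    by rewrite /GRing.scale/= /q; field.
  have dqp := @is_derive1_comp _ (fun x => `|x| `^ p) q _ _ _
    (is_derive_norm_powR (q s) p1) dq.
  have dG := is_deriveM dqp dS.
  have dvp := @is_derive1_comp _ (fun x => `|x| `^ p) v _ _ _
    (is_derive_norm_powR (v s) p1) (dv s).
  apply: is_derive_eq (is_deriveB (is_deriveZ (cp p * c `^ (p - 1)) dG)
    (is_deriveZ (a `^ (p - 1)) dvp)) _.
  rewrite /GRing.scale/=; congr (_ * _ - _).
  rewrite -(mul_spow (q s) p0); field; exact: sS0.
- by move=> s sS; exact: hardy_line_pointwise.
(* The quotient [q] takes the default value 0 at [S] and may jump there. Replacing it by the
   continuous Caratheodory slope [g] of [v] at [S] leaves [G] unchanged, since the factor [s - S]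
   vanishes at [S]. *)
- have cG : {for S, continuous G}.
    have [g [gE cg _]] := (is_derive1_caratheodory v S (v' S)).1 (dv S).
    rewrite (_ : G = fun z => `|g z| `^ p * (z - S)).
      by apply: (@cfM _ _ _); [apply: (@cnp g _)|exact: cS].
    apply/funext => z; rewrite /G /q; have [->|zS] := eqVneq z S.
      by rewrite !subrr !mulr0.
    by rewrite gE mulfK// subr_eq0.
  by apply: (@cfB _ _ _); apply: (@ccM _ _ _) => //; apply: (@cnp _ _); exact: cv.
(* For [|s| >= N + |S|] the function [v] vanishes and only the term in [G] survives; its sign is
   that of [s - S]. *)
- move=> s Ns; rewrite /Phi vN; last first.
    by move: (normr_ge0 S) (ler_norm s); lra.
  rewrite normr0 (powR0 (_ : p != 0)) ?gt_eqF// mulr0 subr0.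
  apply: mulr_ge0; first by rewrite mulr_ge0 ?powR_ge0// ltW.
  by rewrite mulr_ge0 ?powR_ge0// subr_ge0; move: (ler_norm S); lra.
- move=> s Ns; rewrite /Phi vN; last first.
    by move: (normr_ge0 S) (ler_norm (- s)); rewrite normrN; lra.
  rewrite normr0 (powR0 (_ : p != 0)) ?gt_eqF// mulr0 subr0.
  apply: mulr_ge0_le0; first by rewrite mulr_ge0 ?powR_ge0// ltW.
  apply: mulr_ge0_le0; first exact: powR_ge0.
  by move: (ler_norm (- S)); rewrite normrN; lra.
Qed.

End hardy_line.

(** * Lebesgue integrals under scalar dilations *)

Section dilation_integral.
Context {R : realType}.
Local Open Scope ereal_scope.

(** Lebesgue measure agrees with [c] times its image under [x |-> c x] on half-open intervals, hence
    everywhere by uniqueness. *)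
Lemma ge0_integral_scale (c : R) (f : R -> \bar R) : (0 < c)%R ->
  measurable_fun [set: R] f -> (forall x, 0 <= f x) ->
  \int[lebesgue_measure]_x f (c * x)%R = c^-1%:E * \int[lebesgue_measure]_x f x.
Proof.
move=> c0 mf f0.
pose phi : R -> measurableTypeR R := fun x => (c * x)%R.
have mphi : measurable_fun [set: measurableTypeR R] phi by exact: mulrl_measurable.
pose pm : {measure set (measurableTypeR R) -> \bar R} :=
  measure_function_pushforward__canonical__measure_function_Measure
    (@lebesgue_measure R) mphi.
pose cn : {nonneg R} := NngNum (ltW c0).
have E A : measurable A -> lebesgue_measure A = mscale cn pm A.
  apply: lebesgue_measure_unique => _ [[a b]] /= _ <-.
  rewrite /mscale /= /pushforward /=.
  have -> : phi @^-1` `]a, b] = `](a / c)%R, (b / c)%R]%classic.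
    apply/seteqP; split => x /=; rewrite !in_itv/= /phi.
      by move=> /andP[? ?]; rewrite ltr_pdivrMr// ler_pdivlMr// ![(x * _)%R]mulrC; apply/andP.
    by rewrite ltr_pdivrMr// ler_pdivlMr// ![(x * _)%R]mulrC.
  rewrite !lebesgue_measure_itv/= !lte_fin ltr_pM2r ?invr_gt0//.
  case: ifPn => ab; last by rewrite mule0.
  by rewrite -!EFinD -EFinM -mulrBl mulrC divfK// gt_eqF.
have -> : \int[lebesgue_measure]_x f x = \int[mscale cn pm]_x f x.
  by apply: eq_measure_integral => A mA _; exact: E.
rewrite ge0_integral_mscale//=.
rewrite muleA -EFinM mulVf ?gt_eqF// mul1e.
by rewrite ge0_integral_pushforward//.
Qed.

Lemma ge0_integral_rVS n (f : 'rV[R]_n.+1 -> \bar R) :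
  measurable_fun [set: 'rV[R]_n.+1] f -> (forall x, 0 <= f x) ->
  \int[lebesgue_rV n.+1]_x f x =
  \int[lebesgue_measure]_t \int[lebesgue_rV n]_y f (rV_cons (t, y)).
Proof.
move=> mf f0.
pose pr : {measure set (measurableTypeR R * 'rV[R]_n)%type -> \bar R} :=
  (@lebesgue_measure R \x @lebesgue_rV R n).
pose pm : {measure set 'rV[R]_n.+1 -> \bar R} :=
  measure_function_pushforward__canonical__measure_function_Measure
    pr (@measurable_rV_cons R n).
transitivity (\int[pm]_x f x).
  by apply: eq_measure_integral => A mA _.
rewrite ge0_integral_pushforward//; last exact: measurable_rV_cons.
rewrite /= preimage_setT fubini_tonelli1//.
by apply: measurableT_comp => //; exact: measurable_rV_cons.
Qed.

Lemma measurable_scale_rV n (c : R) :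
  measurable_fun [set: 'rV[R]_n] (fun x : 'rV[R]_n => (c *: x)%R).
Proof.
apply: measurable_fun_rV => i; under eq_fun do rewrite mxE.
by apply: measurable_funM => //; exact: measurable_coord.
Qed.

(** Induction on the dimension: Tonelli splits off the first coordinate, which contributes one
    factor [c^-1]. *)
Lemma ge0_integral_scale_rV n (c : R) (f : 'rV[R]_n -> \bar R) : (0 < c)%R ->
  measurable_fun [set: 'rV[R]_n] f -> (forall x, 0 <= f x) ->
  \int[lebesgue_rV n]_x f (c *: x)%R = (c ^- n)%:E * \int[lebesgue_rV n]_x f x.
Proof.
move=> c0; elim: n f => [|n IH] f mf f0.
  rewrite expr0 invr1 mul1e; apply: eq_integral => x _.
  by congr f; rewrite [RHS]thinmx0 [LHS]thinmx0.
have mcons t : measurable_fun [set: 'rV[R]_n] (fun y => f (rV_cons (t, y))).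
  apply: (measurableT_comp mf).
  by apply: (measurableT_comp (@measurable_rV_cons R n)); exact: measurable_fun_pair.
rewrite !ge0_integral_rVS//; last exact: (measurableT_comp mf (@measurable_scale_rV n.+1 c)).
have scale_cons t y : (c *: rV_cons (t, y) = rV_cons ((c * t)%R, (c *: y)%R))%R.
  apply/rowP => i; rewrite mxE; case: (unliftP ord0 i) => [j|] ->.
    by rewrite !rV_consES mxE.
  by rewrite !rV_consE0.
under eq_integral do under eq_integral do rewrite scale_cons.
under eq_integral do rewrite (IH (fun y => f (rV_cons ((c * _)%R, y))))//.
pose F t := \int[lebesgue_rV n]_y f (rV_cons (t, y)).
have mF : measurable_fun [set: R] F.
  apply: (@measurable_fun_fubini_tonelli_F _ _ _ _ _ (@lebesgue_rV R n) (f \o @rV_cons R n)).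
    exact: (measurableT_comp mf (@measurable_rV_cons R n)).
  by move=> x; exact: f0.
have F0 t : 0 <= F t by exact: integral_ge0.
transitivity (\int[lebesgue_measure]_t ((c ^- n)%:E * F (c * t)%R)) => //.
rewrite ge0_integralZl//; last 2 first.
- by apply: measurableT_comp => //; exact: mulrl_measurable.
- by rewrite lee_fin invr_ge0 exprn_ge0// ltW.
by rewrite ge0_integral_scale// muleA -EFinM -invfM -exprSr.
Qed.

End dilation_integral.

(** * Open sets and continuous functions are measurable *)

Section grushin_measurability.
Context {R : realType} {n : nat}.

(** Rational centre and radius [1 / (k + 1)]: a countable family of open cubes. *)
Let box (q : 'rV[rat]_n * rat * nat) : set (grushin R n) :=
  [set z : grushin R n | (forall i, `|z.1 ord0 i - ratr (q.1.1 ord0 i)| < q.2.+1%:R^-1) /\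
           `|z.2 - ratr q.1.2| < q.2.+1%:R^-1].

Let measurable_box q :
  measurable (box q : set ('rV[R]_n * measurableTypeR R)%type).
Proof.
pose A i := [set x : 'rV[R]_n |
  `|x ord0 i - ratr (q.1.1 ord0 i)| < q.2.+1%:R^-1].
pose B := [set t : measurableTypeR R | `|t - ratr q.1.2| < q.2.+1%:R^-1].
rewrite (_ : box q = (\bigcap_(i in [set: 'I_n]) A i) `*` B); last first.
  apply/seteqP; split => z [h1 h2]; split => //.
    by move=> i _; exact: h1.
  by move=> i; exact: (h1 i I).
have bm (c r : R) : measurable ([set t | `|t - c| < r] : set (measurableTypeR R)).
  have -> : [set t | `|t - c| < r] = ball (c : R) r.
    by rewrite -ball_normE; apply/seteqP; split => t /=; rewrite distrC.
  exact: measurable_ball.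
apply: measurableX; last exact: bm.
apply: fin_bigcap_measurable => // i _.
have := measurable_coord i measurableT (bm (ratr (q.1.1 ord0 i)) q.2.+1%:R^-1).
by rewrite setTI.
Qed.

(** The sigma-algebra comes from the coordinates and not from the topology. The link is that [U] is
    the union of the countably many rational boxes contained in it. *)
Lemma open_measurable_grushin (U : set (grushin R n)) : open U ->
  measurable (U : set ('rV[R]_n * measurableTypeR R)%type).
Proof.
move=> oU.
have -> : U = \bigcup_q [set z | box q z /\ box q `<=` U].
  apply/seteqP; split => [z Uz|z [q _ [bz bU]]]; last exact: bU.
  have /nbhs_ballP[e /= e0 eU] : nbhs z U by exact: open_nbhs_nbhs.
  have e20 : 0 < e / 2 by rewrite divr_gt0.
  near \oo => k.
  (* Half of [e], because [z] and any other point of the box are compared through its centre. *)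
  have ke : k.+1%:R^-1 < e / 2.
    by near: k; exact: (near_infty_natSinv_lt (PosNum e20)).
  have k0 : 0 < k.+1%:R^-1 :> R by rewrite invr_gt0.
  have rat_near (x : R) : {q : rat | `|x - ratr q| < k.+1%:R^-1}.
    apply: cid; have xk : x - k.+1%:R^-1 < x + k.+1%:R^-1.
      by rewrite ltrBlDr -addrA ltrDl addr_gt0.
    have [q /[!in_itv]/= qx] := rat_in_itvoo xk.
    by exists q; rewrite distrC ltr_distl.
  exists ((\row_i sval (rat_near (z.1 ord0 i)), sval (rat_near z.2)), k) => //=.
  split.
    split => /=; last by case: (rat_near z.2).
    by move=> i; rewrite mxE; case: (rat_near _).
  move=> y [/= h1 h2]; apply: eU.
  have close (a b : R) c : `|a - c| < k.+1%:R^-1 -> `|b - c| < k.+1%:R^-1 -> ball a e b.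
    move=> ac bc; rewrite -ball_normE /=.
    have -> : a - b = (a - c) - (b - c) by ring.
    by rewrite (le_lt_trans (ler_normB _ _))// [e]splitr ltrD// (lt_trans _ ke).
  split; last first.
    by apply: close h2; case: (rat_near z.2).
  split => // i j; rewrite (ord1 i).
  apply: close (h1 j); rewrite mxE; by case: (rat_near _).
apply: countable_bigcupT_measurable; first exact: countableP.
move=> q; have [bU|bU] := pselect (box q `<=` U).
  rewrite (_ : [set _ | _] = box q)//.
  by apply/seteqP; split => [z []//|z].
rewrite (_ : [set _ | _] = set0)//.
by apply/seteqP; split => [z []//|z].
Unshelve. all: by end_near. Qed.

Lemma continuous_measurable_grushin (u : grushin R n -> R) : continuous u ->
  measurable_fun [set: 'rV[R]_n * measurableTypeR R] u.
Proof.
move=> cu; apply: (measurability _ (RGenOInfty.measurableE R)) => _ [_ [x ->] <-].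
rewrite setTI; apply: open_measurable_grushin.
by move/continuousP : cu; apply; rewrite set_itvE; exact: open_gt.
Qed.

End grushin_measurability.

(** * The homogeneous norm, and the anisotropic dilations acting on Lebesgue measure *)

Section grushin_polar.
Context {R : realType} {n : nat}.
Implicit Types (s : R) (z : grushin R n).

(* The exponential parameter makes dilations a one-parameter group for +. *)
Definition dil s z : grushin R n := (expR s *: z.1, expR s ^+ 2 * z.2).

Lemma enormZ (c : R) (x : 'rV[R]_n) : 0 <= c -> enorm (c *: x) = c * enorm x.
Proof.
move=> c0; rewrite /enorm.
under eq_bigr do rewrite mxE exprMn.
by rewrite -mulr_sumr sqrtrM ?sqr_ge0// sqrtr_sqr ger0_norm.
Qed.

Lemma enorm_ge0 (x : 'rV[R]_n) : 0 <= enorm x.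
Proof. exact: sqrtr_ge0. Qed.

Lemma enorm_sqr (x : 'rV[R]_n) : enorm x ^+ 2 = \sum_(i < n) x ord0 i ^+ 2.
Proof. by rewrite sqr_sqrtr// sumr_ge0// => i _; rewrite sqr_ge0. Qed.

Lemma rho_ge0 z : 0 <= rho z.
Proof. exact: powR_ge0. Qed.

Let rho4_ge0 z : 0 <= enorm z.1 ^+ 4 + 4 * z.2 ^+ 2.
Proof. by apply: addr_ge0; [rewrite exprn_ge0// enorm_ge0|rewrite mulr_ge0// sqr_ge0]. Qed.

Lemma rho_pow4 z : rho z ^+ 4 = enorm z.1 ^+ 4 + 4 * z.2 ^+ 2.
Proof.
by rewrite -powR_mulrn ?powR_ge0// /rho -powRrM mulVf// powRr1//; exact: rho4_ge0.
Qed.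

Lemma enorm_le_rho z : enorm z.1 <= rho z.
Proof.
rewrite -(@ler_pXn2r _ 4)// ?nnegrE ?rho_ge0 ?enorm_ge0// rho_pow4 lerDl.
by rewrite mulr_ge0// sqr_ge0.
Qed.

Lemma coord_le_enorm (x : 'rV[R]_n) i : `|x ord0 i| <= enorm x.
Proof.
rewrite -sqrtr_sqr ler_sqrt ?sumr_ge0// => [|j _]; last exact: sqr_ge0.
by rewrite (bigD1 i)//= lerDl sumr_ge0// => j _; exact: sqr_ge0.
Qed.

Lemma norm_le_rho_sqr z : `|z.2| <= rho z ^+ 2.
Proof.
rewrite -(@ler_pXn2r _ 2)// ?nnegrE ?exprn_ge0 ?rho_ge0// -exprM rho_pow4.
have := sqr_ge0 z.2; have := exprn_ge0 4 (enorm_ge0 z.1).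
by rewrite real_normK ?num_real//; lra.
Qed.

Lemma rho_gt0 z : z != 0 -> 0 < rho z.
Proof.
rewrite lt_neqAle rho_ge0 andbT; apply: contra_neq => /esym r0.
have e0 : enorm z.1 = 0.
  by apply: le_anti; rewrite enorm_ge0 -r0 enorm_le_rho.
have t0 : z.2 = 0.
  apply/eqP; rewrite -normr_le0; have := norm_le_rho_sqr z.
  by rewrite r0 expr0n.
rewrite [z]surjective_pairing t0; congr pair; apply/rowP => i; rewrite mxE.
apply/eqP; rewrite -normr_le0; have := coord_le_enorm z.1 i.
by rewrite e0.
Qed.

Lemma rho0 : rho (0 : grushin R n) = 0.
Proof.
have e0 : enorm (0 : 'rV[R]_n) = 0.
  by rewrite /enorm big1 ?sqrtr0// => i _; rewrite mxE expr0n.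
by rewrite /rho /= e0 !expr0n/= mulr0 addr0 powR0// invr_neq0.
Qed.

Lemma rho_eq0 z : (rho z == 0) = (z == 0).
Proof.
apply/eqP/eqP => [rz|->]; last exact: rho0.
by apply/eqP; apply: contraT => /rho_gt0; rewrite rz ltxx.
Qed.

Lemma rho_dil s z : rho (dil s z) = expR s * rho z.
Proof.
have e0 : 0 <= expR s by exact: expR_ge0.
apply: (@pexpIrn _ 4); rewrite ?nnegrE ?mulr_ge0 ?rho_ge0//.
by rewrite exprMn !rho_pow4 /= enormZ//; ring.
Qed.

Lemma psi_dil s z : psi (dil s z) = psi z.
Proof.
rewrite /psi rho_dil /= enormZ ?expR_ge0// !exprMn.
by rewrite -mulf_div divff ?mul1r// expf_neq0// gt_eqF ?expR_gt0.
Qed.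

Lemma measurable_enorm : measurable_fun [set: 'rV[R]_n] (@enorm R n).
Proof.
apply: (measurableT_comp (continuous_measurable_fun (@sqrt_continuous R))).
apply: measurable_sum => i; apply: measurable_funX; exact: measurable_coord.
Qed.

Lemma measurable_rho : measurable_fun [set: 'rV[R]_n * measurableTypeR R] (@rho R n).
Proof.
apply: (measurableT_comp (@measurable_powR R _)); apply: measurable_funD.
  apply: measurable_funX.
  exact: (measurableT_comp measurable_enorm (@measurable_fst _ _ _ _)).
apply: measurable_funM => //; apply: measurable_funX.
exact: measurable_snd.
Qed.

Lemma measurable_grushin_set0 :
  measurable ([set 0] : set ('rV[R]_n * measurableTypeR R)%type).
Proof.
rewrite (_ : [set 0] = @rho R n @^-1` [set 0]).
  by rewrite -[X in measurable X]setTI; exact: measurable_rho.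
by apply/seteqP; split => z /=; [move=> ->; exact: rho0|move/eqP; rewrite rho_eq0 => /eqP].
Qed.

Lemma measurable_scale_fun d (T : measurableType d) (c : T -> R) (x : T -> 'rV[R]_n) :
  measurable_fun [set: T] c -> measurable_fun [set: T] x ->
  measurable_fun [set: T] (fun w => c w *: x w).
Proof.
move=> mc mx; apply: measurable_fun_rV => i; under eq_fun do rewrite mxE.
apply: measurable_funM => //.
exact: (measurableT_comp (measurable_coord i) mx).
Qed.

(** Measurability jointly in the point and the parameter, for Tonelli over both. *)
Lemma measurable_dil2 :
  measurable_fun [set: ('rV[R]_n * measurableTypeR R) * measurableTypeR R]
    (fun w => dil w.2 w.1 : 'rV[R]_n * measurableTypeR R).
Proof.
have mexp : measurable_fun [set: ('rV[R]_n * measurableTypeR R) * measurableTypeR R]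
    (fun w => expR w.2 : R).
  exact: (measurableT_comp (@measurable_expR R) (@measurable_snd _ _ _ _)).
apply: measurable_fun_pair.
  apply: measurable_scale_fun => //.
  exact: (measurableT_comp (@measurable_fst _ _ _ _) (@measurable_fst _ _ _ _)).
apply: measurable_funM; first exact: measurable_funX.
exact: (measurableT_comp (@measurable_snd _ _ _ _) (@measurable_fst _ _ _ _)).
Qed.

Lemma measurable_dil s :
  measurable_fun [set: 'rV[R]_n * measurableTypeR R]
    (fun z => dil s z : 'rV[R]_n * measurableTypeR R).
Proof.
apply: measurable_fun_pair; first exact: measurable_scale_fun.
by apply: measurable_funM => //; exact: measurable_snd.
Qed.

Lemma measurable_orbit z :
  measurable_fun [set: measurableTypeR R]
    (fun s => dil s z : 'rV[R]_n * measurableTypeR R).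
Proof.
have mexp := @measurable_expR R.
apply: measurable_fun_pair; first exact: measurable_scale_fun.
by apply: measurable_funM => //; exact: measurable_funX.
Qed.

Lemma lebesgueG_set0 : lebesgueG [set (0 : grushin R n)] = 0%E.
Proof.
rewrite /lebesgueG (_ : [set _] = [set (0 : 'rV[R]_n)] `*` [set (0 : R)]).
  rewrite product_measure1E//.
    rewrite [X in (_ * X)%E](_ : _ = 0%E) ?mule0//; exact: lebesgue_measure_set1.
  rewrite (_ : [set 0] = \bigcap_(i in [set: 'I_n])
     ((fun x : 'rV[R]_n => x ord0 i : measurableTypeR R) @^-1` [set 0])).
    apply: fin_bigcap_measurable => // i _.
    have := measurable_coord i measurableT (measurable_set1 (0 : measurableTypeR R)).
    by rewrite setTI.
  apply/seteqP; split => [x -> i _ /=|x h]; first by rewrite mxE.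
  by apply/rowP => i; rewrite mxE; exact: h.
by apply/seteqP; split => [_ ->//|[a b] [/= -> ->]].
Qed.

Local Open Scope ereal_scope.

(** The variable [x] contributes [e^(- n s)] and [t] contributes [e^(- 2 s)], whence the homogeneous
    dimension [n + 2]. *)
Lemma ge0_integral_dil s (f : grushin R n -> \bar R) :
  measurable_fun [set: 'rV[R]_n * measurableTypeR R] f -> (forall z, 0 <= f z) ->
  \int[lebesgueG]_z f (dil s z) =
  (expR (- (hdim R n * s)))%:E * \int[lebesgueG]_z f z.
Proof.
move=> mf f0.
have e0 : (0 < expR s)%R by exact: expR_gt0.
have e20 : (0 < expR s ^+ 2)%R by rewrite exprn_gt0.
rewrite /lebesgueG !fubini_tonelli1//; last first.
  exact: (measurableT_comp mf (measurable_dil s)).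
rewrite /fubini_F/=.
pose F x := \int[lebesgue_measure]_t f (x, t).
have mF : measurable_fun [set: 'rV[R]_n] F.
  exact: (@measurable_fun_fubini_tonelli_F _ _ _ _ _ (@lebesgue_measure R) f).
have F0 x : 0 <= F x by exact: integral_ge0.
have inner x : \int[lebesgue_measure]_t f (dil s (x, t)) =
    ((expR s ^+ 2)^-1)%:E * F (expR s *: x)%R.
  rewrite -(@ge0_integral_scale _ _ (fun t => f ((expR s *: x)%R, t)))//.
  by apply: (measurableT_comp mf); exact: measurable_fun_pair.
under eq_integral do rewrite inner.
rewrite ge0_integralZl//; last first.
  exact: (measurableT_comp mF (@measurable_scale_rV R n (expR s))).
rewrite ge0_integral_scale_rV// muleA -EFinM; congr (_%:E * _).
rewrite -!expRM_natl -!expRN -expRD /hdim natrD; congr expR; ring.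
Qed.

End grushin_polar.

(** * Sigma-finiteness of Lebesgue measure on the Grushin space *)

Section lebesgueG_sigma_finite.
Context {R : realType} {n : nat}.

(** Required for Tonelli between [lebesgueG] and the dilation parameter. *)
Let lebesgueG_sigma_finite : sigma_finite setT (@lebesgueG R n).
Proof.
have /sigma_finiteP[F [TF ndF Foo]] := sigma_finiteT (@lebesgue_rV R n).
have /sigma_finiteP[G [TG ndG Goo]] := sigma_finiteT (@lebesgue_measure R).
exists (fun k => F k `*` G k).
  apply/seteqP; split => // -[x y] _.
  have : setT x by []. have : setT y by [].
  rewrite TF TG => -[j _ Gy] [i _ Fx]; exists (maxn i j) => //; split => /=.
  - by move: x Fx; exact/subsetPset/ndF/leq_maxl.
  - by move: y Gy; exact/subsetPset/ndG/leq_maxr.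
move=> k; have [mF Fk] := Foo k; have [mG Gk] := Goo k.
split; first exact: measurableX.
by rewrite /lebesgueG product_measure1E// lte_mul_pinfty// ge0_fin_numE.
Qed.

HB.instance Definition _ := Measure.on (@lebesgueG R n).
HB.instance Definition _ := Measure_isSigmaFinite.Build _ _ _
  (@lebesgueG R n) lebesgueG_sigma_finite.

End lebesgueG_sigma_finite.

(** * Integration along dilation orbits *)

Section grushin_polar_formula.
Context {R : realType} {n : nat}.

(* Any weight with [integral_shell] would do. *)
Definition shell (r : R) : R := \1_(`[1, expR 1[%classic) r.

Local Open Scope ereal_scope.

Lemma shell_ge0 (r : R) : 0 <= (shell r)%:E.
Proof. by rewrite lee_fin /shell indicE. Qed.

Lemma measurable_shell : measurable_fun [set: R] shell.
Proof. by apply: measurable_indic; exact: measurable_itv. Qed.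

(** The condition [1 <= e^(-s) r < e] says that [s] lies in the interval []ln r - 1, ln r]], of
    length 1. *)
Lemma integral_shell (r : R) : (0 < r)%R ->
  \int[lebesgue_measure]_s (shell (expR (- s) * r)%R)%:E = 1.
Proof.
move=> r0.
transitivity (\int[lebesgue_measure]_s (\1_(`](ln r - 1)%R, ln r]%classic) s)%:E).
  apply: eq_integral => s _; congr EFin; rewrite /shell !indicE; congr (nat_of_bool _)%:R.
  rewrite -{1}(lnK r0) -expRD !mem_setE !in_itv/=.
  rewrite -[X in (X <= expR _ < _)%R]expR0 ler_expR ltr_expR.
  by move: s => s; apply/idP/idP; lra.
rewrite integral_indic ?setIT//.
rewrite [LHS]lebesgue_measure_itv/= lte_fin ltrBlDr ltrDl ltr01 -EFinB.
by congr EFin; ring.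
Qed.

(** [K] is [f] times a weight of integral one in [s]. Exchanging the integrals, substituting
    [dil s z] for [z] at fixed [s] and exchanging back turns [K] into [H]. *)
Lemma ge0_integral_polar (f : grushin R n -> \bar R) :
  measurable_fun [set: 'rV[R]_n * measurableTypeR R] f -> (forall z, 0 <= f z) ->
  \int[lebesgueG]_z f z =
  \int[lebesgueG]_z ((shell (rho z))%:E *
     \int[lebesgue_measure]_s ((expR (hdim R n * s)%R)%:E * f (dil s z))).
Proof.
move=> mf f0.
pose H (w : ('rV[R]_n * measurableTypeR R) * measurableTypeR R) :=
  (shell (rho w.1))%:E * ((expR (hdim R n * w.2)%R)%:E * f (dil w.2 w.1)).
pose K (w : ('rV[R]_n * measurableTypeR R) * measurableTypeR R) :=
  f w.1 * (shell (expR (- w.2) * rho w.1)%R)%:E.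
have mfst d1 d2 (T1 : measurableType d1) (T2 : measurableType d2) :
  measurable_fun [set: T1 * T2] fst by exact: measurable_fst.
have msnd d1 d2 (T1 : measurableType d1) (T2 : measurableType d2) :
  measurable_fun [set: T1 * T2] snd by exact: measurable_snd.
have mrho1 : measurable_fun [set: ('rV[R]_n * measurableTypeR R) * measurableTypeR R]
   (fun w => rho w.1 : R) by exact: (measurableT_comp measurable_rho (mfst _ _ _ _)).
have mH : measurable_fun setT H.
  apply: emeasurable_funM.
    apply/measurable_EFinP; exact: (measurableT_comp measurable_shell mrho1).
  apply: emeasurable_funM; last exact: (measurableT_comp mf measurable_dil2).
  apply/measurable_EFinP; apply: (measurableT_comp (@measurable_expR R)).
  by apply: measurable_funM => //; exact: msnd.
have H0 w : 0 <= H w.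
  by rewrite /H !mule_ge0 ?shell_ge0// lee_fin expR_ge0.
have mK : measurable_fun setT K.
  apply: emeasurable_funM; first exact: (measurableT_comp mf (mfst _ _ _ _)).
  apply/measurable_EFinP; apply: (measurableT_comp measurable_shell).
  apply: measurable_funM => //; apply: (measurableT_comp (@measurable_expR R)).
  by apply: measurable_funN; exact: msnd.
have K0 w : 0 <= K w by rewrite /K mule_ge0// shell_ge0.
transitivity (\int[lebesgueG]_z \int[lebesgue_measure]_s K (z, s)).
  have KE z : z != 0%R -> \int[lebesgue_measure]_s K (z, s) = f z.
    move=> z0; rewrite /K /= ge0_integralZl//.
    - by rewrite integral_shell ?mule1// rho_gt0.
    - apply/measurable_EFinP; apply: (measurableT_comp measurable_shell).
      apply: measurable_funM => //; apply: (measurableT_comp (@measurable_expR R)).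
      exact: measurable_funN.
    - by move=> s _; exact: shell_ge0.
  (* At the origin the weight vanishes for every [s], so the equality holds only off this null
     point. *)
  apply: ge0_ae_eq_integral => //.
  - exact: (@measurable_fun_fubini_tonelli_F _ _ _ _ _ (@lebesgue_measure R) K).
  - by move=> z _; exact: integral_ge0.
  exists [set 0%R]; split.
  - exact: measurable_grushin_set0.
  - exact: lebesgueG_set0.
  - move=> z /= zN; apply: contrapT => z0; apply: zN => _; rewrite KE//.
    by apply/eqP.
rewrite [LHS](fubini_tonelli (m1 := @lebesgueG R n) (m2 := lebesgue_measure) K)//.
transitivity (\int[lebesgue_measure]_s \int[lebesgueG]_z H (z, s)).
  apply: eq_integral => s _; rewrite /K /H /=.
  pose h (y : grushin R n) := (shell (expR (- s) * rho y)%R)%:E * f y.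
  have mh : measurable_fun [set: 'rV[R]_n * measurableTypeR R] h.
    apply: emeasurable_funM => //.
    apply/measurable_EFinP; apply: (measurableT_comp measurable_shell).
    by apply: measurable_funM => //; exact: measurable_rho.
  have h0 y : 0 <= h y by rewrite mule_ge0// shell_ge0.
  transitivity (\int[lebesgueG]_z h z).
    by apply: eq_integral => z _; rewrite muleC.
  have := ge0_integral_dil s mh h0.
  move=> /(congr1 (fun x => (expR (hdim R n * s)%R)%:E * x)).
  rewrite muleA -EFinM -expRD subrr expR0 mul1e => <-.
  rewrite -ge0_integralZl//; last exact: (measurableT_comp mh (measurable_dil s)).
  apply: eq_integral => z _.
  by rewrite /h rho_dil mulrA -expRD addNr expR0 mul1r muleCA.
rewrite -[LHS](fubini_tonelli (m1 := @lebesgueG R n) (m2 := lebesgue_measure) H)//.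
apply: eq_integral => z _; rewrite /H /= ge0_integralZl ?shell_ge0//.
- apply: emeasurable_funM.
    apply/measurable_EFinP; apply: (measurableT_comp (@measurable_expR R)).
    exact: measurable_funM.
  exact: (measurableT_comp mf (measurable_orbit z)).
- by move=> s _; rewrite mule_ge0// lee_fin expR_ge0.
Qed.

End grushin_polar_formula.

(** * The Grushin gradient of [rho] *)

Section gradient_rho.
Context {R : realType} {n : nat}.
Implicit Types (z : grushin R n).

Lemma derive_line (f : grushin R n -> R) z v d :
  is_derive (0 : R) 1 (fun h => f (h *: v + z)) d -> 'D_v f z = d.
Proof.
move=> [_ <-]; rewrite /derive.
set G := (X in lim (X @ _)); set H := (X in _ = lim (X @ _)).
suff -> : G = H by [].
apply/funext => h; rewrite /G /H /= scale0r add0r addr0.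
by rewrite [h *: 1]mulr1.
Qed.

Let P z : R := enorm z.1 ^+ 4 + 4 * z.2 ^+ 2.

Let P_gt0 z : z != 0 -> 0 < P z.
Proof. by move=> /rho_gt0 r0; rewrite /P -rho_pow4 exprn_gt0. Qed.

(** Chain rule for [rho = P^(1/4)], where [P > 0] off the origin and [P^(-3/4) = rho^(-3)]; [g] is
    [P] along the line through [z] in direction [v]. *)
Let derive_rho z v (g : R -> R) d : z != 0 ->
  (forall h, P (h *: v + z) = g h) -> is_derive (0 : R) 1 g d ->
  'D_v (@rho R n) z = d / 4 / rho z ^+ 3.
Proof.
move=> z0 gE dg; apply: derive_line.
have g0 : g 0 = P z by rewrite -gE scale0r add0r.
have gP : 0 < g 0 by rewrite g0 P_gt0.
rewrite (_ : (fun h => _) = (@powR R ^~ 4^-1) \o g); last first.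
  by apply/funext => h; rewrite /= -gE.
apply: is_derive_eq (is_derive1_comp (is_derive1_powR 4^-1 gP) dg) _.
have -> : g 0 `^ (4^-1 - 1) = (rho z ^+ 3)^-1.
  rewrite g0 /P -rho_pow4 -powR_mulrn ?rho_ge0// -powRrM.
  have -> : 4%:R * (4^-1 - 1) = - 3%:R :> R by lra.
  by rewrite powRN powR_mulrn ?rho_ge0.
by field; rewrite gt_eqF// rho_gt0.
Qed.

Lemma dx_rho i z : z != 0 ->
  dx i (@rho R n) z = enorm z.1 ^+ 2 * z.1 ord0 i / rho z ^+ 3.
Proof.
move=> z0; rewrite /dx.
pose g h := (enorm z.1 ^+ 2 + 2 * h * z.1 ord0 i + h ^+ 2) ^+ 2 + 4 * z.2 ^+ 2.
have dg : is_derive (0 : R) 1 g (4 * enorm z.1 ^+ 2 * z.1 ord0 i).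
  apply/is_derive1_caratheodory.
  (* The divided difference [(g h - g 0) / h], factored as a difference of two squares. *)
  exists (fun h => (2 * z.1 ord0 i + h) * (2 * enorm z.1 ^+ 2 + 2 * z.1 ord0 i * h + h * h)).
  split; [by move=> h; rewrite /g; ring| |by ring].
  have cid : {for (0 : R), continuous (fun h : R => h)} by exact: cvg_id.
  have ccst (k : R) : {for (0 : R), continuous (fun h : R => k)} by exact: cst_continuous.
  by apply: continuousM; repeat (apply: continuousD || apply: continuousM).
rewrite (derive_rho z0 _ dg).
  by field; rewrite gt_eqF// rho_gt0.
move=> h; rewrite /P /g /= scaler0 add0r; congr (_ + _).
rewrite (_ : 4 = 2 * 2)%N// exprM; congr (_ ^+ 2).
rewrite !enorm_sqr (bigD1 i)//= [in RHS](bigD1 i)//= !mxE !eqxx/=.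
rewrite (eq_bigr (fun j => z.1 ord0 j ^+ 2)); last first.
  by move=> j ji; rewrite !mxE (negbTE ji) andbF mulr0 add0r.
by set S := \sum_(_ < _ | _) _; ring.
Qed.

Lemma dt_rho z : z != 0 -> dt (@rho R n) z = 2 * z.2 / rho z ^+ 3.
Proof.
move=> z0; rewrite /dt.
pose g h := enorm z.1 ^+ 4 + 4 * (h + z.2) ^+ 2.
have dg : is_derive (0 : R) 1 g (8 * z.2).
  apply/is_derive1_caratheodory; exists (fun h => 8 * z.2 + 4 * h).
  split; [by move=> h; rewrite /g; ring| |by ring].
  have cid : {for (0 : R), continuous (fun h : R => h)} by exact: cvg_id.
  have ccst (k : R) : {for (0 : R), continuous (fun h : R => k)} by exact: cst_continuous.
  by apply: continuousD => //; exact: continuousM.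
rewrite (derive_rho z0 _ dg).
  by field; rewrite gt_eqF// rho_gt0.
by move=> h; rewrite /P /g /= scaler0 add0r [h *: 1]mulr1.
Qed.

(** The squared components add up to [|x|^6 / rho^6] and [4 t^2 |x|^2 / rho^6], and
    [|x|^4 + 4 t^2 = rho^4]. *)
Lemma enormG_gradG_rho z : z != 0 -> enormG (gradG (@rho R n) z) = Num.sqrt (psi z).
Proof.
move=> z0; rewrite /enormG /gradG /=; congr Num.sqrt.
have r0 : rho z != 0 by rewrite gt_eqF// rho_gt0.
rewrite enorm_sqr dt_rho//.
under eq_bigr do rewrite mxE dx_rho// mulrAC exprMn.
rewrite -mulr_sumr -enorm_sqr /psi.
have -> : (enorm z.1 ^+ 2 / rho z ^+ 3) ^+ 2 * enorm z.1 ^+ 2 +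
   (enorm z.1 * (2 * z.2 / rho z ^+ 3)) ^+ 2 =
   enorm z.1 ^+ 2 * (enorm z.1 ^+ 4 + 4 * z.2 ^+ 2) / rho z ^+ 6.
  by field.
by rewrite -rho_pow4; field.
Qed.

Lemma psi_le1 z : psi z <= 1.
Proof.
have [->|z0] := eqVneq z 0.
  by rewrite /psi rho0 expr0n/= invr0 mulr0.
rewrite ler_pdivrMr ?exprn_gt0 ?rho_gt0// mul1r.
by rewrite lerXn2r// ?nnegrE ?rho_ge0 ?enorm_ge0// enorm_le_rho.
Qed.

End gradient_rho.

(** * Differentiation along orbits *)

Section orbit_calculus.
Context {R : realType} {n : nat}.
Implicit Types (u : grushin R n -> R) (z : grushin R n) (s : R).

(** The infinitesimal generator of the dilations, equal to [rho * drho] off the origin; having no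
    denominator, it stays continuous at the origin for a test function. *)
Definition euler u z : R := \sum_(i < n) z.1 ord0 i * dx i u z + 2 * z.2 * dt u z.

Lemma drhoE u z : drho u z = (rho z)^-1 * euler u z.
Proof. by []. Qed.

Lemma diff_euler u z : differentiable u z -> 'd u z (z.1, 2 * z.2) = euler u z.
Proof.
move=> du.
have -> : (z.1, 2 * z.2) = \sum_(i < n) z.1 ord0 i *: ((delta_mx ord0 i, 0) : grushin R n)
    + (2 * z.2) *: ((0, 1) : grushin R n).
  have sumE (I : Type) (r : seq I) (F : I -> grushin R n) :
      \sum_(i <- r) F i = (\sum_(i <- r) (F i).1, \sum_(i <- r) (F i).2).
    elim: r => [|i r IH]; first by rewrite !big_nil.
    by rewrite !big_cons IH.
  rewrite sumE /= [X in (X, _) + _](_ : _ = z.1); last first.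
    rewrite [RHS]row_sum_delta; apply: eq_bigr => i _.
    by [].
  rewrite big1 => [|i _]; last by rewrite scaler0.
  by congr pair; rewrite /= ?scaler0 ?addr0// add0r [RHS]mulr1.
rewrite linearD linearZ linear_sum /euler /dx /dt; congr (_ + _).
  by apply: eq_bigr => i _; rewrite linearZ deriveE.
by rewrite deriveE.
Qed.

Let is_derive_expR2 s (t : R) : is_derive s (1 : R) (fun s => expR s ^+ 2 * t)
  (2 * (expR s ^+ 2 * t)).
Proof.
have d := is_derive_expR s.
apply: is_derive_eq (is_deriveM (is_deriveM d d) (is_derive_cst t s (1 : R))) _.
by rewrite /GRing.scale /= expr2; ring.
Qed.

Let differentiable_expR s : differentiable (@expR R) s.
Proof. by apply/derivable1_diffP; have [] := is_derive_expR s. Qed.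

Lemma differentiable_orbit z s : differentiable (fun s : R => dil s z) s.
Proof.
apply: differentiable_pair; first exact: differentiableZl.
by apply/derivable1_diffP; have [] := is_derive_expR2 s z.2.
Qed.

(** The velocity of an orbit is [(x, 2 t)] at the current point, the vector on which [diff_euler]
    evaluates the differential. *)
Lemma diff_orbit z s :
  'd (fun s : R => dil s z) s (1 : R) = ((dil s z).1, 2 * (dil s z).2).
Proof.
have d2 : differentiable (fun s : R => expR s ^+ 2 * z.2) s.
  by apply/derivable1_diffP; have [] := is_derive_expR2 s z.2.
rewrite (diff_pair (f := fun s => expR s *: z.1)) //; last exact: differentiableZl.
rewrite diffZl// -!deriveE//.
have [_ ->] := is_derive_expR s.
by have [_ ->] := is_derive_expR2 s z.2.
Qed.

Lemma is_derive_orbit u z s : differentiable u (dil s z) ->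
  is_derive s (1 : R) (fun s => u (dil s z)) (euler u (dil s z)).
Proof.
move=> du; have dg := differentiable_orbit z s.
have dc : differentiable (u \o (fun s : R => dil s z)) s.
  exact: differentiable_comp.
apply: DeriveDef; first exact: (@diff_derivable _ _ _ (u \o (fun s : R => dil s z))).
rewrite (deriveE (f := u \o (fun s : R => dil s z)))// diff_comp//=.
by rewrite diff_orbit diff_euler.
Qed.

End orbit_calculus.

(** * Bounds and regularity of test functions *)

Section test_function_facts.
Context {R : realType} {n : nat}.
Implicit Types (u : grushin R n -> R) (z : grushin R n) (s : R).

Lemma ball0_grushinP z (e : R) : 0 < e ->
  ball (0 : grushin R n) e z <-> (forall i, `|z.1 ord0 i| < e) /\ `|z.2| < e.
Proof.
move=> e0; split => [[[_ b1] b2]|[b1 b2]].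
  split => [i|]; first by have := b1 ord0 i; rewrite mxE -ball_normE /= sub0r normrN.
  by move: b2; rewrite -ball_normE /= sub0r normrN.
split; last by rewrite -ball_normE /= sub0r normrN.
by split => // i j; rewrite (ord1 i) mxE -ball_normE /= sub0r normrN.
Qed.

(** The support misses a ball about the origin ([m]), is bounded ([M]), and has a compact image
    under [u] ([C]). *)
Lemma test_function_bounds u : test_function_off0 u ->
  exists m M C : R, [/\ 0 < m, 0 <= C &
    forall z, u z != 0 -> [/\ m <= rho z, rho z <= M & `|u z| <= C]].
Proof.
move=> [su cs s0].
have cu : continuous u.
  by move=> z; apply: differentiable_continuous; exact: (su [::] z).
set supp := closure _ in cs s0.
have supp_u z : u z != 0 -> supp z by move=> uz; exact: subset_closure.
have [e e0 eP] : exists2 e : R, 0 < e & forall z, ball (0 : grushin R n) e z -> ~ supp z.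
  have : nbhs (0 : grushin R n) (~` supp).
    apply: open_nbhs_nbhs; split => //; apply: closed_openC; exact: closed_closure.
  by move=> /nbhs_ballP[e /= e0 eP]; exists e.
have [B B0 BP] : exists2 B : R, 0 < B & forall z, supp z -> `|z| < B.
  have [B0 [_ BP]] := compact_bounded cs.
  exists (`|B0| + 2); first by rewrite ltr_wpDl.
  move=> z sz; apply: (@le_lt_trans _ _ (`|B0| + 1)); last by rewrite ltrD2l ltr1n.
  by apply: BP => //; rewrite (le_lt_trans (ler_norm _))// ltrDl.
have [C C0 CP] : exists2 C : R, 0 <= C & forall z, supp z -> `|u z| <= C.
  have cus : compact (u @` supp).
    by apply: continuous_compact => //; exact: continuous_subspaceT.
  have [C0 [_ CP]] := compact_bounded cus.
  exists (`|C0| + 1); first by rewrite addr_ge0.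
  move=> z sz; apply: CP; last by exists z.
  by rewrite (le_lt_trans (ler_norm _))// ltrDl.
(* If [rho < 1] then [|t| <= rho^2 <= rho], so [rho < min e 1] puts [z] in the ball of radius [e].
   The second witness is 1 plus a bound for [rho^4], which dominates [rho] whether or not
   [rho <= 1]. *)
exists (Num.min e 1), (1 + ((n%:R * B ^+ 2) ^+ 2 + 4 * B ^+ 2)), C; split => //.
  by rewrite lt_min e0 ltr01.
move=> z uz; have sz := supp_u z uz; split; last exact: CP.
- rewrite leNgt; apply/negP; rewrite lt_min => /andP[re r1]; apply: (eP z) sz.
  apply/ball0_grushinP => //; split => [i|].
    by rewrite (le_lt_trans (coord_le_enorm _ _))// (le_lt_trans (enorm_le_rho _)).
  rewrite (le_lt_trans (norm_le_rho_sqr _))// (le_lt_trans _ re)//.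
  by rewrite expr2 ler_piMl ?rho_ge0// ltW.
- have /ball0_grushinP : ball (0 : grushin R n) B z.
    by rewrite -ball_normE /= sub0r normrN; exact: BP.
  move=> /(_ B0) [b1 b2].
  have sqB (x : R) : `|x| < B -> x ^+ 2 <= B ^+ 2.
    move=> /ltW xB; rewrite -[leLHS]real_normK ?num_real//.
    by apply: lerXn2r; rewrite ?nnegrE// ltW.
  have r4 : rho z ^+ 4 <= (n%:R * B ^+ 2) ^+ 2 + 4 * B ^+ 2.
    have e2 : enorm z.1 ^+ 2 <= n%:R * B ^+ 2.
      rewrite enorm_sqr (@le_trans _ _ (\sum_(i < n) B ^+ 2))//.
        by apply: ler_sum => i _; exact: sqB.
      by rewrite sumr_const card_ord mulr_natl.
    have e20 : 0 <= enorm z.1 ^+ 2 := sqr_ge0 _.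
    rewrite rho_pow4; apply: lerD.
      rewrite (_ : 4 = 2 * 2)%N// exprM; apply: lerXn2r => //.
      by rewrite nnegrE (le_trans e20).
    by rewrite ler_pM2l//; exact: sqB.
  have [r1|/ltW r1] := leP (rho z) 1.
    by rewrite (le_trans r1)// lerDl (le_trans _ r4)// exprn_ge0// rho_ge0.
  apply: (le_trans _ (le_trans r4 _)); last by rewrite lerDr.
  by rewrite exprS ler_peMr ?rho_ge0// exprn_ege1.
Qed.

Lemma test_function_differentiable u z : test_function_off0 u -> differentiable u z.
Proof. by move=> [su _ _]; exact: (su [::] z). Qed.

Lemma test_function_continuous u : test_function_off0 u -> continuous u.
Proof.
by move=> tu z; apply: differentiable_continuous; exact: test_function_differentiable.
Qed.

(** Smoothness along a one-element list of directions makes each ['D_v u] differentiable, hence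
    continuous. *)
Lemma continuous_euler u : test_function_off0 u -> continuous (euler u).
Proof.
move=> [su _ _] z.
have cD v : 'D_v u y @[y --> z] --> 'D_v u z.
  exact (differentiable_continuous (su [:: v] z)).
have c1 i : (fun y : grushin R n => y.1 ord0 i) @ z --> z.1 ord0 i.
  have h1 : (fun y : grushin R n => y.1) @ z --> z.1 by exact: cvg_fst.
  exact: (cvg_comp _ _ h1 (@coord_continuous R 1 n ord0 i z.1)).
have c2 : (fun y : grushin R n => y.2) @ z --> z.2 by exact: cvg_snd.
have H1 : (fun y : grushin R n => \sum_(i < n) y.1 ord0 i * dx i u y) @ z -->
    \sum_(i < n) z.1 ord0 i * dx i u z.
  by apply: cvg_big => [|i _]; [exact: add_continuous|apply: cvgM; [exact: c1|exact: cD]].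
have H2 : (fun y : grushin R n => 2 * y.2 * dt u y) @ z --> 2 * z.2 * dt u z.
  by apply: cvgM; [apply: cvgM => //; exact: cvg_cst|exact: cD].
exact (cvgD H1 H2).
Qed.

End test_function_facts.

(** * Reduction to orbits, and the three integrands along an orbit *)

Section orbit_comparison.
Context {R : realType} {n : nat}.
Implicit Types (u : grushin R n -> R) (z : grushin R n) (s : R).

(** The polar formula weights both orbit integrals by the same [shell (rho z) >= 0], which is 0 at
    the origin, where the assumption says nothing. *)
Lemma ge0_le_integral_orbits (f g : grushin R n -> \bar R) :
  measurable_fun [set: 'rV[R]_n * measurableTypeR R] f ->
  measurable_fun [set: 'rV[R]_n * measurableTypeR R] g ->
  (forall z, 0 <= f z)%E -> (forall z, 0 <= g z)%E ->
  (forall z, (z != 0)%R ->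
    \int[lebesgue_measure]_s ((expR (hdim R n * s))%:E * f (dil s z)) <=
    \int[lebesgue_measure]_s ((expR (hdim R n * s))%:E * g (dil s z)))%E ->
  (\int[lebesgueG]_z f z <= \int[lebesgueG]_z g z)%E.
Proof.
move=> mf mg f0 g0 fg; rewrite (ge0_integral_polar mf)// (ge0_integral_polar mg)//.
have mF (h : grushin R n -> \bar R) : measurable_fun [set: 'rV[R]_n * measurableTypeR R] h ->
    (forall z, 0 <= h z)%E ->
    measurable_fun [set: 'rV[R]_n * measurableTypeR R] (fun z => ((shell (rho z))%:E *
     \int[lebesgue_measure]_s ((expR (hdim R n * s))%:E * h (dil s z)))%E).
  move=> mh h0; apply: emeasurable_funM.
    apply/measurable_EFinP; exact: (measurableT_comp measurable_shell measurable_rho).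
  apply: (@measurable_fun_fubini_tonelli_F _ _ _ _ _ (@lebesgue_measure R)
    (fun w => ((expR (hdim R n * w.2))%:E * h (dil w.2 w.1))%E)).
    apply: emeasurable_funM; last exact: (measurableT_comp mh measurable_dil2).
    apply/measurable_EFinP; apply: (measurableT_comp (@measurable_expR R)).
    by apply: measurable_funM => //; exact: measurable_snd.
  by move=> w; rewrite mule_ge0// lee_fin expR_ge0.
apply: ge0_le_integral => //.
- move=> z _; rewrite mule_ge0 ?shell_ge0// integral_ge0// => s _.
  by rewrite mule_ge0// lee_fin expR_ge0.
- exact: mF.
- exact: mF.
move=> z _; have [->|z0] := eqVneq z 0; last by rewrite lee_wpmul2l ?shell_ge0 ?fg.
rewrite rho0 (_ : shell 0 = 0) ?mul0e//.
by rewrite /shell indicE memNset//= in_itv/= ler10.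
Qed.

Variables (p beta : R).
Hypotheses (p2 : 2 <= p) (hbeta : beta < hdim R n - p).
Let p0 : 0 < p. Proof. by have := p2; lra. Qed.
Local Notation a := (@hardy_exponent R n p beta).

Lemma hardy_exponent_gt0 : 0 < a.
Proof. by rewrite /hardy_exponent divr_gt0//; have := hbeta; lra. Qed.

Lemma expR_powR (x q : R) : expR x `^ q = expR (x * q).
Proof. by rewrite expRM. Qed.

Lemma powR_inv (x q : R) : 0 <= x -> x^-1 `^ q = (x `^ q)^-1.
Proof. by move=> x0; rewrite -powR_inv1// -powRrM mulN1r powRN. Qed.

(** The exponent of [e^s] is [Q - (p + beta) = a * p], so the whole weight is a [p]-th power and can
    be absorbed into the function. *)
Lemma weight_dil z s : z != 0 ->
  expR (hdim R n * s) / rho (dil s z) `^ (p + beta) =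
  (rho z `^ (- ((p + beta) / p)) * expR (a * s)) `^ p.
Proof.
move=> z0; have r0 := rho_gt0 z0.
rewrite rho_dil !powRM ?rho_ge0 ?expR_ge0 ?powR_ge0//.
rewrite -powRrM !expR_powR mulNr divfK ?gt_eqF// powRN invfM mulrA mulrC.
congr (_ * _); rewrite -expRN -expRD; congr expR.
by rewrite /hardy_exponent; field; rewrite gt_eqF.
Qed.

Definition radial_density u z : R := norm_radial_gradG u z `^ p / rho z `^ beta.

Definition hardy_density u z : R :=
  `|u z| `^ p * enormG (gradG (@rho R n) z) `^ p / rho z `^ (p + beta).

Definition dH_density u (r : R) z : R :=
  `|u z - r `^ a * u ((r / rho z) *: z.1, r ^+ 2 * (z.2 / rho z ^+ 2)) *
      rho z `^ (- a)| `^ p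
  / (`|ln (r / rho z)| `^ p * rho z `^ (p + beta)) * enormG (gradG (@rho R n) z) `^ p.

(* [u] along the orbit of [z], normalised so that the dilation weights of all
   three densities become constant *)
Definition orbit_fun u z s : R :=
  Num.sqrt (psi z) * rho z `^ (- ((p + beta) / p)) * (expR (a * s) * u (dil s z)).

(** The derivative of [orbit_fun] in [s], arranged so that subtracting [a * orbit_fun] leaves just
    the [euler] term. *)
Definition orbit_der u z s : R :=
  a * orbit_fun u z s +
  Num.sqrt (psi z) * rho z `^ (- ((p + beta) / p)) * (expR (a * s) * euler u (dil s z)).

Lemma dil_neq0 z s : z != 0 -> dil s z != 0.
Proof.
by rewrite -!rho_eq0 rho_dil mulf_eq0 (gt_eqF (expR_gt0 s)).
Qed.

(** Since [drho = euler / rho], the power [rho^(-p)] joins [rho^(- beta)] to form the weight of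
    [weight_dil]; [psi] is constant on orbits. *)
Lemma radial_density_dil u z s : z != 0 ->
  expR (hdim R n * s) * radial_density u (dil s z) =
  `|orbit_der u z s - a * orbit_fun u z s| `^ p.
Proof.
move=> z0; have y0 := rho_gt0 (dil_neq0 s z0).
rewrite /orbit_der addrAC subrr add0r /radial_density /norm_radial_gradG drhoE.
rewrite !normrM psi_dil normfV (gtr0_norm y0) (ger0_norm (sqrtr_ge0 _)).
rewrite (ger0_norm (powR_ge0 _ _)) (gtr0_norm (expR_gt0 _)).
rewrite !powRM ?mulr_ge0 ?powR_ge0 ?expR_ge0 ?sqrtr_ge0 ?invr_ge0 ?rho_ge0//.
rewrite powR_inv ?rho_ge0//.
have := weight_dil s z0; rewrite powRM ?powR_ge0 ?expR_ge0//.
rewrite powRD; last by rewrite (gt_eqF y0) implybT.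
rewrite invfM => W; set A := _ `^ p; set E := `|euler _ _| `^ p.
transitivity (A * E * (expR (hdim R n * s) / rho (dil s z) `^ p / rho (dil s z) `^ beta)).
  by ring.
by rewrite -mulrA in W; rewrite -!mulrA W; ring.
Qed.

Lemma hardy_density_dil u z s : z != 0 ->
  expR (hdim R n * s) * hardy_density u (dil s z) = `|orbit_fun u z s| `^ p.
Proof.
move=> z0; rewrite /hardy_density enormG_gradG_rho ?dil_neq0// psi_dil /orbit_fun.
rewrite !normrM (ger0_norm (sqrtr_ge0 _)).
rewrite (ger0_norm (powR_ge0 _ _)) (gtr0_norm (expR_gt0 _)).
rewrite !powRM ?mulr_ge0 ?powR_ge0 ?expR_ge0 ?sqrtr_ge0//.
have := weight_dil s z0; rewrite powRM ?powR_ge0 ?expR_ge0// => W.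
set A := Num.sqrt _ `^ p; set E := `|u _| `^ p.
by rewrite mulrCA W; ring.
Qed.

(** The projection of [dil s z] to the level [rho = r] is [dil S z] for every [s], and
    [ln (r / rho (dil s z)) = S - s]. At [s = S] both sides are 0 by the convention on division. *)
Lemma dH_density_dil u (r : R) z s : z != 0 -> 0 < r ->
  let S := ln (r / rho z) in
  expR (hdim R n * s) * dH_density u r (dil s z) =
  `|(orbit_fun u z s - orbit_fun u z S) / (s - S)| `^ p.
Proof.
move=> z0 r0 S; have rz := rho_gt0 z0.
have SE : expR S = r / rho z by rewrite lnK// posrE divr_gt0.
have es : expR s != 0 by rewrite gt_eqF ?expR_gt0.
rewrite /dH_density enormG_gradG_rho ?dil_neq0// psi_dil.
have -> : ((r / rho (dil s z)) *: (dil s z).1,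
    r ^+ 2 * ((dil s z).2 / rho (dil s z) ^+ 2)) = dil S z.
  rewrite /dil rho_dil SE /= scalerA; congr pair.
    by congr (_ *: _); field; rewrite es gt_eqF.
  by field; rewrite es gt_eqF.
have -> : r / rho (dil s z) = expR (S - s).
  by rewrite rho_dil expRD expRN SE; field; rewrite es gt_eqF.
rewrite expRK.
have -> : r `^ a * u (dil S z) * rho (dil s z) `^ (- a) =
    expR (- (a * s)) * (expR (a * S) * u (dil S z)).
  rewrite rho_dil powRM ?expR_ge0 ?rho_ge0// expR_powR.
  rewrite [expR (a * S)](_ : _ = r `^ a * rho z `^ (- a)).
    by rewrite (_ : s * - a = - (a * s)); ring.
  rewrite mulrC -expR_powR SE powRM ?invr_ge0 ?rho_ge0 ?ltW//.
  by rewrite powR_inv ?ltW// powRN.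
have -> : `|u (dil s z) - expR (- (a * s)) * (expR (a * S) * u (dil S z))| =
    expR (- (a * s)) * `|expR (a * s) * u (dil s z) - expR (a * S) * u (dil S z)|.
  rewrite -[X in X * `|_|](gtr0_norm (expR_gt0 _)) -normrM mulrBr; congr (`|_ - _|).
  by rewrite mulrA -expRD addNr expR0 mul1r.
have -> : orbit_fun u z s - orbit_fun u z S =
  Num.sqrt (psi z) * rho z `^ (- ((p + beta) / p)) *
   (expR (a * s) * u (dil s z) - expR (a * S) * u (dil S z)).
  by rewrite /orbit_fun; ring.
set D := expR (a * s) * _ - _.
rewrite !normrM normfV (ger0_norm (sqrtr_ge0 _)) (ger0_norm (powR_ge0 _ _)) (distrC s S).
rewrite !powRM ?mulr_ge0 ?powR_ge0 ?expR_ge0 ?sqrtr_ge0 ?invr_ge0//.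
rewrite powR_inv//.
have := weight_dil s z0; rewrite powRM ?powR_ge0 ?expR_ge0// => W.
set A := Num.sqrt _ `^ p; set E := `|D| `^ p; set L := `|S - s| `^ p.
transitivity (expR (- (a * s)) `^ p * (expR (hdim R n * s) / rho (dil s z) `^ (p + beta)) *
   (E * A / L)); first by rewrite invfM; ring.
have eE : expR (- (a * s)) `^ p * expR (a * s) `^ p = 1.
  by rewrite -powRM ?expR_ge0// -expRD addNr expR0 powR1.
by rewrite W -[RHS]mul1r -eE; ring.
Qed.

End orbit_comparison.

(** * Measurability of the three integrands *)

Section density_measurability.
Context {R : realType} {n : nat}.
Implicit Types (u f g : grushin R n -> R).
Local Notation M := (measurable_fun [set: 'rV[R]_n * measurableTypeR R]).

Let mpow f (q : R) : M f -> M (fun z => f z `^ q).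
Proof. by move=> mf; exact: (measurableT_comp (@measurable_powR R q) mf). Qed.

Let mnorm f : M f -> M (fun z => `|f z|).
Proof. by move=> mf; exact: (measurableT_comp (@normr_measurable R setT) mf). Qed.

Let minv f : M f -> M (fun z => (f z)^-1).
Proof. by move=> mf; exact: (measurableT_comp measurable_invr mf). Qed.

Let mdiv f g : M f -> M g -> M (fun z => f z / g z).
Proof. by move=> mf mg; apply: measurable_funM => //; exact: minv. Qed.

Let mrho : M (@rho R n) := measurable_rho.

Lemma measurable_sqrt_psi : M (fun z => Num.sqrt (psi z)).
Proof.
apply: (measurableT_comp (continuous_measurable_fun (@sqrt_continuous R))).
apply: mdiv; apply: measurable_funX => //.
exact: (measurableT_comp measurable_enorm (@measurable_fst _ _ _ _)).
Qed.

(** The formula [sqrt psi] is known off the origin only. The value at the origin is added,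
    uncomputed, through the indicator of that point, where [psi] is 0 by convention. *)
Lemma measurable_enormG_gradG_rho : M (fun z => enormG (gradG (@rho R n) z)).
Proof.
rewrite (_ : (fun z => _) = fun z => Num.sqrt (psi z) +
    enormG (gradG (@rho R n) 0) * \1_[set (0 : grushin R n)] z).
  apply: measurable_funD; first exact: measurable_sqrt_psi.
  by apply: measurable_funM => //; apply: measurable_indic; exact: measurable_grushin_set0.
apply/funext => z; rewrite indicE; have [->|z0] := eqVneq z 0.
  by rewrite mem_set// mulr1 /psi rho0 expr0n/= invr0 mulr0 sqrtr0 add0r.
by rewrite memNset/= ?mulr0 ?addr0 ?enormG_gradG_rho//; exact/eqP.
Qed.

Variables (p beta : R) (u : grushin R n -> R).
Hypothesis tu : test_function_off0 u.

Let mu : M u := continuous_measurable_grushin (test_function_continuous tu).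

Lemma measurable_radial_density : M (radial_density p beta u).
Proof.
apply: mdiv; last exact: mpow.
apply: mpow; apply: measurable_funM; first exact: measurable_sqrt_psi.
apply: mnorm; apply: measurable_funM; first exact: minv.
exact: (continuous_measurable_grushin (continuous_euler tu)).
Qed.

Lemma measurable_hardy_density : M (hardy_density p beta u).
Proof.
apply: mdiv; last exact: mpow.
apply: measurable_funM; apply: mpow; first exact: mnorm.
exact: measurable_enormG_gradG_rho.
Qed.

Lemma measurable_dH_density r : M (dH_density p beta u r).
Proof.
have mr : M (fun z => r / rho z) by apply: mdiv.
apply: measurable_funM; last by apply: mpow; exact: measurable_enormG_gradG_rho.
apply: mdiv.
  apply: mpow; apply: mnorm; apply: measurable_funB => //.
  apply: measurable_funM; last exact: mpow.
  apply: measurable_funM => //.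
  apply: (measurableT_comp mu); apply: measurable_fun_pair.
    by apply: measurable_scale_fun => //; exact: measurable_fst.
  apply: measurable_funM => //; apply: mdiv; first exact: measurable_snd.
  exact: measurable_funX.
apply: measurable_funM; last exact: mpow.
apply: mpow; apply: mnorm.
exact: (measurableT_comp (@measurable_ln R) mr).
Qed.

End density_measurability.

(** * Finiteness of the Hardy term, and the inequality for a fixed radius *)

Section grushin_hardy.
Context {R : realType} {n : nat}.
Variables (p beta : R) (u : grushin R n -> R).
Hypotheses (p2 : 2 <= p) (hbeta : beta < hdim R n - p).
Hypothesis tu : test_function_off0 u.
Local Notation a := (@hardy_exponent R n p beta).
Let p0 : 0 < p. Proof. by have := p2; lra. Qed.

Lemma radial_density_ge0 z : 0 <= radial_density p beta u z.
Proof. by rewrite divr_ge0 ?powR_ge0. Qed.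

Lemma hardy_density_ge0 z : 0 <= hardy_density p beta u z.
Proof. by rewrite divr_ge0 ?mulr_ge0 ?powR_ge0. Qed.

Lemma dH_density_ge0 r z : 0 <= dH_density p beta u r z.
Proof. by rewrite mulr_ge0 ?divr_ge0 ?mulr_ge0 ?powR_ge0. Qed.

Let cube (B : R) : set 'rV[R]_n :=
  [set x | forall i, (`[- B, B]%classic : set (measurableTypeR R)) (x ord0 i)].

Let box (B : R) : set ('rV[R]_n * measurableTypeR R)%type :=
  cube B `*` `[- B, B]%classic.

Let measurable_cube B : measurable (cube B).
Proof.
rewrite (_ : cube B = \bigcap_(i in [set: 'I_n])
  ((fun x : 'rV[R]_n => x ord0 i : measurableTypeR R) @^-1` `[- B, B]%classic)); last first.
  by apply/seteqP; split => [x Ax i _|x Ax i] //=; exact: (Ax i).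
apply: fin_bigcap_measurable => // i _.
by rewrite -[X in measurable X]setTI; apply: measurable_coord => //; exact: measurable_itv.
Qed.

Let measurable_box B : measurable (box B).
Proof. by apply: measurableX => //; exact: measurable_itv. Qed.

Let lebesgueG_box_lty B : (lebesgueG (box B) < +oo)%E.
Proof.
have itv_fin : lebesgue_measure (`[- B, B]%classic : set R) \is a fin_num.
  by rewrite lebesgue_measure_itv; case: ifP.
have cube_fin : lebesgue_rV n (cube B) \is a fin_num.
  rewrite (lebesgue_rV_box (A := fun=> `[- B, B]%classic)); last first.
    by move=> i; exact: measurable_itv.
  by elim/big_ind : _ => // x y xf yf; rewrite fin_numM.
have := product_measure1E (@lebesgue_rV R n) (@lebesgue_measure R)
  (measurable_cube B) (measurable_itv `[- B, B]).
rewrite /lebesgueG /box => ->.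
by rewrite ltey_eq fin_numM.
Qed.

Lemma hardy_density_bounded : exists K B : R, 0 <= K /\
  forall z, hardy_density p beta u z <= K * \1_(box B) z.
Proof.
have [m [M [C [m0 C0 bnd]]]] := test_function_bounds tu.
pose q := p + beta.
(* Since [q] may have either sign, both endpoint values enter the bound of [rho^(-q)] on [[m, M]].
   The box radius comes from [|x_i| <= rho <= M] and [|t| <= rho^2 <= M^2]. *)
exists (C `^ p * (m `^ (- q) + M `^ (- q))), (Num.max M (M ^+ 2)); split.
  by rewrite mulr_ge0 ?addr_ge0 ?powR_ge0.
move=> z; have [uz|uz] := eqVneq (u z) 0.
  rewrite /hardy_density uz normr0 powR0 ?gt_eqF// !mul0r mulr_ge0//.
  by rewrite mulr_ge0 ?addr_ge0 ?powR_ge0.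
have [mz zM uC] := bnd z uz.
have rz : 0 < rho z by exact: lt_le_trans mz.
have z0 : z != 0 by apply: contraTneq rz => ->; rewrite rho0 ltxx.
have M0 : 0 < M by exact: lt_le_trans zM.
rewrite indicE mem_set ?mulr1; last first.
  split => [i|] /=; rewrite in_itv/= -ler_norml le_max.
    by rewrite (le_trans (coord_le_enorm _ _))// (le_trans (enorm_le_rho _)).
  apply/orP; right; apply: (le_trans (norm_le_rho_sqr _)).
  by apply: lerXn2r => //; rewrite nnegrE ltW.
rewrite /hardy_density enormG_gradG_rho// -powRN -/q.
apply: ler_pM; rewrite ?mulr_ge0 ?powR_ge0//.
  rewrite -[leRHS]mulr1 ler_pM ?powR_ge0//.
    by apply: ge0_ler_powR; rewrite ?nnegrE// ltW.
  rewrite -[leRHS](_ : 1 `^ p = 1); last by rewrite powR1.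
  apply: ge0_ler_powR; rewrite ?nnegrE ?sqrtr_ge0//; first exact: ltW.
  by rewrite -[leRHS]sqrtr1 ler_sqrt ?psi_le1.
have [q0|/ltW q0] := leP 0 q.
  rewrite (@le_trans _ _ (m `^ (- q)))// ?lerDl ?powR_ge0// !powRN.
  rewrite (lef_pV2 (powR_gt0 q rz) (powR_gt0 q m0)).
  by apply: ge0_ler_powR; rewrite ?nnegrE// ltW.
rewrite (@le_trans _ _ (M `^ (- q)))// ?lerDr ?powR_ge0//.
by apply: ge0_ler_powR; rewrite ?nnegrE ?oppr_ge0// ltW.
Qed.

(** Finiteness allows the Hardy term to be moved across an inequality of extended reals. *)
Lemma hardy_term_fin_num : hardy_term p beta u \is a fin_num.
Proof.
rewrite ge0_fin_numE; last by apply: integral_ge0 => z _; rewrite lee_fin hardy_density_ge0.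
have [K [B [K0 KB]]] := hardy_density_bounded.
apply: (@le_lt_trans _ _ (\int[lebesgueG]_z (K * \1_(box B) z)%:E)%E).
  apply: ge0_le_integral => //.
  - by move=> z _; rewrite lee_fin hardy_density_ge0.
  - by apply/measurable_EFinP; exact: measurable_hardy_density.
  - by apply/measurable_EFinP; apply: measurable_funM => //; exact: measurable_indic.
  - by move=> z _; rewrite lee_fin; exact: KB.
under eq_integral do rewrite EFinM.
rewrite ge0_integralZl//; last exact/measurable_EFinP/measurable_indic.
rewrite integral_indic// setIT ltey_eq fin_numM//.
by rewrite ge0_fin_numE//; exact: lebesgueG_box_lty.
Qed.

Lemma orbit_fun_support z : z != 0 -> exists N : R, 0 <= N /\
  forall s, N <= `|s| -> orbit_fun p beta u z s = 0.
Proof.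
move=> z0; have [m [M [C [m0 C0 bnd]]]] := test_function_bounds tu.
have rz := rho_gt0 z0.
(* Where [u (dil s z) != 0], the bounds [m <= e^s rho z <= M] place [s] between the two logarithms;
   adding 1 makes the exclusion strict. *)
exists (`|ln (m / rho z)| + `|ln (M / rho z)| + 1); split; first by rewrite !addr_ge0.
move=> s Ns; rewrite /orbit_fun; have [->|us] := eqVneq (u (dil s z)) 0.
  by rewrite !mulr0.
have [] := bnd _ us; rewrite rho_dil => ms sM _.
have M0 : 0 < M by apply: lt_le_trans sM; rewrite mulr_gt0 ?expR_gt0.
have s1 : ln (m / rho z) <= s.
  by rewrite -ler_expR lnK ?posrE ?divr_gt0// ler_pdivrMr.
have s2 : s <= ln (M / rho z).
  by rewrite -ler_expR lnK ?posrE ?divr_gt0// ler_pdivlMr.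
exfalso; move: Ns (ler_norm (ln (M / rho z))) (ler_norm (- ln (m / rho z))).
move: (normr_ge0 (ln (M / rho z))) (normr_ge0 (ln (m / rho z))); rewrite normrN.
have [s0|s0] := leP 0 s; [rewrite (ger0_norm s0)|rewrite (ltr0_norm s0)]; lra.
Qed.

Lemma is_derive_orbit_fun z s :
  is_derive s (1 : R) (orbit_fun p beta u z) (orbit_der p beta u z s).
Proof.
have d1 := is_derive_orbit (test_function_differentiable (dil s z) tu).
have d2 : is_derive s (1 : R) (fun s => expR (a * s)) (a * expR (a * s)).
  have da : is_derive s (1 : R) (fun s : R => a * s) a.
    by apply: is_derive_eq (is_deriveZ a (is_derive_id s (1 : R))) _; rewrite [LHS]mulr1.
  apply: is_derive_eq (@is_derive1_comp _ expR (fun s => a * s) _ _ _ (is_derive_expR _) da) _.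
  by rewrite mulrC.
apply: is_derive_eq (is_deriveZ
  (Num.sqrt (psi z) * rho z `^ (- ((p + beta) / p))) (is_deriveM d2 d1)) _.
by rewrite /GRing.scale/= /orbit_der /orbit_fun; ring.
Qed.

Lemma continuous_orbit_der z : continuous (orbit_der p beta u z).
Proof.
suff H (s : R) : orbit_der p beta u z t @[t --> s] --> orbit_der p beta u z s by [].
have cE : (fun t : R => expR (a * t)) @ s --> expR (a * s).
  apply: (cvg_comp (fun t => a * t) expR); last exact: continuous_expR.
  by apply: cvgM; [exact: cvg_cst|exact: cvg_id].
have cg : (fun t : R => dil t z) @ s --> dil s z.
  exact (differentiable_continuous (differentiable_orbit z s)).
have cu : (fun t : R => u (dil t z)) @ s --> u (dil s z).
  exact (cvg_comp _ _ cg (@test_function_continuous R n u tu (dil s z))).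
have ce : (fun t : R => euler u (dil t z)) @ s --> euler u (dil s z).
  exact (cvg_comp _ _ cg (@continuous_euler R n u tu (dil s z))).
apply: cvgD.
  by apply: cvgM; [exact: cvg_cst|apply: cvgM; [exact: cvg_cst|exact: cvgM]].
by apply: cvgM; [exact: cvg_cst|exact: cvgM].
Qed.

(** With the left side merged into one integral, the comparison reduces to single orbits. There the
    three density identities turn it into [hardy_line] for [orbit_fun] with [S = ln (r / rho z)]. *)
Lemma grushin_hardy_remainder (r : R) : 0 < r ->
  ((a `^ p)%:E * hardy_term p beta u +
   (cp p * ((p - 1) / p) `^ p)%:E * \int[lebesgueG]_z (dH_density p beta u r z)%:E
   <= radial_energy p beta u)%E.
Proof.
move=> r0; have [_ cp0 _] := cp_properties p2.
set c := cp p * _; have c0 : 0 <= c by rewrite mulr_ge0 ?powR_ge0// ltW.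
have mH := measurable_hardy_density p beta tu.
have mD := measurable_dH_density p beta tu r.
have mE := measurable_radial_density p beta tu.
have ap0 : 0 <= a `^ p by exact: powR_ge0.
have -> : ((a `^ p)%:E * hardy_term p beta u +
    c%:E * \int[lebesgueG]_z (dH_density p beta u r z)%:E =
  \int[lebesgueG]_z (a `^ p * hardy_density p beta u z + c * dH_density p beta u r z)%:E)%E.
  transitivity (\int[lebesgueG]_z ((a `^ p)%:E * (hardy_density p beta u z)%:E +
      c%:E * (dH_density p beta u r z)%:E))%E; last by [].
  have mH' : measurable_fun setT (EFin \o hardy_density p beta u) by exact/measurable_EFinP.
  have mD' : measurable_fun setT (EFin \o dH_density p beta u r) by exact/measurable_EFinP.
  have H0 z : (0 <= (hardy_density p beta u z)%:E)%E by rewrite lee_fin hardy_density_ge0.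
  have D0 z : (0 <= (dH_density p beta u r z)%:E)%E by rewrite lee_fin dH_density_ge0.
  rewrite ge0_integralD//.
  - by rewrite !ge0_integralZl.
  - by move=> z _; rewrite mule_ge0.
  - exact: emeasurable_funM.
  - by move=> z _; rewrite mule_ge0.
  - exact: emeasurable_funM.
apply: (@ge0_le_integral_orbits _ _ _ (fun z => (radial_density p beta u z)%:E)).
- by apply/measurable_EFinP; apply: measurable_funD; exact: measurable_funM.
- exact/measurable_EFinP.
- move=> z; rewrite lee_fin; apply: addr_ge0; apply: mulr_ge0 => //.
    exact: hardy_density_ge0.
  exact: dH_density_ge0.
- by move=> z; rewrite lee_fin radial_density_ge0.
move=> z z0.
have [N [N0 vN]] := orbit_fun_support z0.
have := @hardy_line R p a (ln (r / rho z)) N _ _ p2 (hardy_exponent_gt0 p2 hbeta) N0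
  (is_derive_orbit_fun z) (@continuous_orbit_der z) vN.
congr (_ <= _)%E; apply: eq_integral => s _; rewrite -EFinM; congr EFin.
  rewrite mulrDr mulrCA hardy_density_dil// mulrCA dH_density_dil//.
by rewrite radial_density_dil.
Qed.

End grushin_hardy.

(** The estimate for a fixed radius has a constant independent of the radius, so it passes to the
    supremum. *)
Theorem theorem1p2 (R : realType) (n : nat) (p beta : R) :
  (1 <= n)%N -> 2 <= p -> p < hdim R n -> beta < hdim R n - p ->
  [/\ is_min (cp_values p) (cp p), 0 < cp p &
    forall u : grushin R n -> R, test_function_off0 u ->
      (radial_energy p beta u
         - (((hdim R n - p - beta) / p) `^ p)%:E * hardy_term p beta u
       >= (cp p * ((p - 1) / p) `^ p)%:E
          * ereal_sup [set (dH p beta u r `^ p)%E | r in [set r : R | (0 < r)%R]])%E].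
Proof.
move=> _ p2 _ hbeta; have [cpmin cp0 _] := cp_properties p2; split => // u tu.
have c0 : 0 < cp p * ((p - 1) / p) `^ p.
  by rewrite mulr_gt0// powR_gt0// divr_gt0//; lra.
(* Dividing by the positive constant isolates the supremum, which is then bounded radius by
   radius. *)
rewrite -lee_pdivlMl//; apply: ge_ereal_sup => _ [r /= r0 <-].
rewrite lee_pdivlMl// leeBrDl ?fin_numM ?hardy_term_fin_num//.
(* The [p]-th power cancels the [p]-th root of the nonnegative integral. *)
rewrite /dH -poweRrM mulVf ?gt_eqF//; last by lra.
rewrite poweRe1; last first.
  by apply: integral_ge0 => z _; rewrite lee_fin (dH_density_ge0 p beta u r).
exact: grushin_hardy_remainder.
Qed.
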